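(* Let $\mathcal{P}=(\mathcal{PV},\mathcal{L},\ell_0,\mathcal{T})$ be an integer program and $\mathcal{C}=\{t_1,\ldots,t_n\}\subset\mathcal{T}$ a simple cycle with $t_k=(\ell_k,\_,\_,\ell_{k+1})$ for $1\le k\le n-1$ and $t_n=(\ell_n,\_,\_,\ell_1)$. Define ${\mathcal{RB}_{\text{loc}}}:\mathcal{E}_{\mathcal{C}}\to\mathcal{B}$ as follows (this is the output of the algorithm). For $r\in\mathcal{E}_{\mathcal{C}}$, let $i$ be such that the target location of $r$ is $\ell_i$, and let $t=t_i\star\cdots\star t_n\star t_1\star\cdots\star t_{i-1}=(\ell_i,\varphi,\eta,\ell_i)$. If there is a bijective renaming $\pi$ of $\mathcal{PV}$ and a subset $\mathcal{PV}'=\{x_1,\ldots,x_d\}\subseteq\mathcal{PV}$ such that the renamed transition $\pi(t)=(\ell_i,\varphi_\pi,\eta_\pi,\ell_i)$ satisfies $\varphi_\pi\in\mathcal{F}(\mathcal{PV}')$, $\eta_\pi(x_k)=c_kx_k+p_k$ with $c_k\in\mathbb{Z}$ and $p_k\in\mathbb{Z}[x_{k+1},\ldots,x_d]$ for $1\le k\le d$, and $\eta_\pi(v)=v$ for $v\in\mathcal{PV}\setminus\mathcal{PV}'$, then choose $\psi\in\mathcal{F}(\mathcal{PV}')$ with $\models\psi\to\eta_\pi(\psi)$ such that $\sigma(\pi^{-1}(\psi))$ holds whenever $(\ell_0,\sigma_0)\to^*_{\mathcal{T}}\circ\to_r(\ell_i,\sigma)$ for some $\sigma_0$ (where $\pi^{-1}(\psi)$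 renames each variable $x$ to $\pi^{-1}(x)$), let $L=(\psi,\varphi_\pi,\eta_\pi|_{\mathcal{PV}'})$, and set ${\mathcal{RB}_{\text{loc}}}(r)=\pi^{-1}(1+B)$, where $B={\operatorname{sth}^{\sqcup}}$ for a stabilization bound polynomial ${\operatorname{sth}^{\sqcup}}$ of $L$ if $L$ is a terminating tnn-loop, $B=2\cdot{\operatorname{sth}^{\sqcup}}+1$ for a stabilization bound polynomial ${\operatorname{sth}^{\sqcup}}$ of $L\star L$ if $L$ is a terminating twn-loop but not a tnn-loop, and $B=\omega$ otherwise; if no such $\pi$ exists, set ${\mathcal{RB}_{\text{loc}}}(r)=\omega$. Then ${\mathcal{RB}_{\text{loc}}}$ is a local runtime bound for $\mathcal{C}=\mathcal{T}'_>=\mathcal{T}'$ in $\mathcal{P}$.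
   Context: Integer programs: $\mathcal{F}(\mathcal{V})$ are propositional formulas ($\land,\lor$) over atoms $q_1<q_2$, $q_i\in\mathbb{Z}[\mathcal{V}]$. An integer program $(\mathcal{PV},\mathcal{L},\ell_0,\mathcal{T})$ has a finite set $\mathcal{PV}\subseteq\mathcal{V}$ of program variables (others are temporary), finite locations $\mathcal{L}$ with initial $\ell_0$, and finite transitions $(\ell,\varphi,\eta,\ell')$ with $\ell'\neq\ell_0$, guard $\varphi\in\mathcal{F}(\mathcal{V})$, update $\eta:\mathcal{PV}\to\mathbb{Z}[\mathcal{V}]$. States are $\sigma:\mathcal{V}\to\mathbb{Z}$; $|\sigma|(v)=|\sigma(v)|$; $(\ell,\sigma)\to_s(\ell',\sigma')$ for $s=(\ell,\varphi,\eta,\ell')$ iff $\sigma(\varphi)$ holds and $\sigma'(v)=\sigma(\eta(v))$ for $v\in\mathcal{PV}$; $\to_{\mathcal{T}}$ is the union over $\mathcal{T}$, $\to^*$ reflexive-transitive closure. Bounds $\mathcal{B}$: smallest set containing $\mathbb{N}\cup\{\omega\}$ and $\mathcal{PV}$, closed under $+,\cdot$, $k^b$ ($k\in\mathbb{N}$). $\mathcal{E}_{\mathcal{T}'}$: transitions in $\mathcal{T}\setminus\mathcal{T}'$ whose target is the start location of a transition of $\mathcal{T}'$. A local runtime bound for $\mathcal{T}'_>$ w.r.t. $\mathcal{T}'$ is ${\mathcal{RB}_{\text{loc}}}:\mathcal{E}_{\mathcal{T}'}\to\mathcal{B}$ with $|\sigma|({\mathcal{RB}_{\text{loc}}}(r))\ge\sup\{k\mid\exists\sigma_0,\ell'',(\ell',\sigma').\,(\ell_0,\sigma_0)\to^*_{\mathcal{T}}\circ\to_r(\ell'',\sigma)(\to^*_{\mathcal{T}'}\circ\to_s)^k(\ell',\sigma')\}$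 for all $s\in\mathcal{T}'_>$, $r\in\mathcal{E}_{\mathcal{T}'}$, states $\sigma$. Simple cycle: $\mathcal{C}=\{t_1,\ldots,t_n\}$ contains no temporary variables and there are pairwise different locations $\ell_1,\ldots,\ell_n$ with $t_k$ going from $\ell_k$ to $\ell_{k+1}$ ($k<n$) and $t_n$ from $\ell_n$ to $\ell_1$. Chaining of $s_1,\ldots,s_m$ with $s_k=(\ell_k,\varphi_k,\eta_k,\ell_{k+1})$: $s_1\star\cdots\star s_m=(\ell_1,\varphi,\eta,\ell_{m+1})$ with $\varphi=\varphi_1\land\eta_1(\varphi_2)\land\eta_2(\eta_1(\varphi_3))\land\cdots\land\eta_{m-1}(\cdots\eta_1(\varphi_m)\cdots)$ and $\eta=\eta_m\circ\cdots\circ\eta_1$ (applying an update to a formula substitutes $\eta(v)$ for each $v$). Twn-loops: $(\psi,\varphi,\eta)$ over $\{x_1,\ldots,x_d\}$ is the program with transitions $(\ell_0,\psi,\mathrm{id},\ell)$ and $(\ell,\varphi,\eta,\ell)$, with $\models\psi\to\eta(\psi)$ and $\eta(x_k)=c_kx_k+p_k$, $c_k\in\mathbb{Z}$, $p_k\in\mathbb{Z}[x_{k+1},\ldots,x_d]$; tnn-loop if all $c_k\ge0$; terminating if it has no infinite evaluation. $L\star L$ for $L=(\psi,\varphi,\eta)$ is $(\psi,\varphi\land\eta(\varphi),\eta\circ\eta)$. Stabilization bound polynomial of a terminating tnn-loop $L=(\psi,\varphi,\eta)$: let $\psi'=\psi\land\varphi$, $\Psi'=\{\vec e\in\mathbb{Z}^d\mid\sigma_{\vec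 e}(\psi')\}$ with $\sigma_{\vec e}(x_k)=e_k$. Take a normalized closed form $\overline{\vec x}$ of $\eta$ with start value $n_0$ (expressions over $\vec x$ and $n$ with $\sigma(\overline{x_k})=\sigma(\eta^n(x_k))$ whenever $\sigma(n)\ge n_0$) whose components have the form $\sum_j p_jn^{a_j}b_j^n$, $p_j\in\mathbb{Q}[\vec x]$, $a_j\in\mathbb{N}$, $b_j\in\mathbb{N}_{\ge1}$. For each atom $\alpha=(s_1<s_2)$ of $\varphi$, $npe_\alpha$ is $(s_2-s_1)[\vec x/\overline{\vec x}]$ multiplied by the lcm of its denominators, written $\sum_{(p,a,b)\in\Lambda}p\,n^ab^n$ with monomials $p$. Choose disjoint $\Delta,\Gamma\subseteq\Lambda$ with $\models\psi'\to p>0$ on $\Delta$, $\models\psi'\to p\le0$ on $\Gamma$, and $i_{(p,a,b)},j_{(p,a,b)}\in\mathbb{N}$ with $(j,i)>_{\mathrm{lex}}(b,a)$ on $\Delta$, $(b,a)>_{\mathrm{lex}}(j,i)$ on $\Gamma$; set $\overline{npe_\alpha}=\sum_{\Delta\cup\Gamma}p\,n^ij^n+\sum_{\Lambda\setminus(\Delta\cup\Gamma)}p\,n^ab^n$, required to be eventually non-positive (if $\overline{npe_\alpha}\neq npe_\alpha$, then for each $\vec e\in\Psi'$, $\sigma_{\vec e}(\overline{npe_\alpha})\le0$ for all large $n$). The $k$-monotonicity threshold of $(b_1,a_1)>_{\mathrm{lex}}(b_2,a_2)$ is the least $n_0$ with $n^{a_1}b_1^n>k\,n^{a_2}b_2^n$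 for all $n\ge n_0$. $D_\alpha$ is the max ($\max\emptyset=0$) of the 1-monotonicity thresholds of $(j,i),(b,a)$ over $\Delta$ and $(b,a),(j,i)$ over $\Gamma$. Write $\overline{npe_\alpha}=\sum_{j=1}^{\ell}p_jn^{a_j}b_j^n$ with $p_j\neq0$, $(b_\ell,a_\ell)>_{\mathrm{lex}}\cdots>_{\mathrm{lex}}(b_1,a_1)$; $C_\alpha=\max\{1,N_2,M_2,\ldots,N_\ell,M_\ell\}$ with $M_j=0$ if $b_j=b_{j-1}$, else the 1-monotonicity threshold of $(b_j,a_j)$ and $(b_{j-1},a_{j-1}+1)$; $N_2=1$, $N_3=mt'$, $N_j=\max\{mt,mt'\}$ ($j>3$), $mt'$ the $(j-2)$-monotonicity threshold of $(b_{j-1},a_{j-1})$ and $(b_{j-2},a_{j-2})$, $mt$ the max of the 1-monotonicity thresholds of $(b_{j-2},a_{j-2})$ and $(b_i,a_i)$, $1\le i\le j-3$. With $Pol=\bigcup_\alpha\{p_1,\ldots,p_{\ell-1}\}$, $C=\max_\alpha C_\alpha$, $D=\max_\alpha D_\alpha$, the polynomial is $2\cdot\sqcup Pol+\max\{n_0,C,D\}$, where $\sqcup\{q_1,\ldots,q_m\}=\sum_{\vec e}c_{\vec e}\vec x^{\vec e}$ with $c_{\vec e}$ the maximal absolute coefficient of $\vec x^{\vec e}$ among the $q_k$ ($0$ if none).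
   Formalization: Chaining is taken in execution order: the guard and update of s_1⋆…⋆s_m describe performing η_1 first, then η_2, etc. (as substitutions η_1(η_2(…))); with the literal nesting η_{m-1}(…η_1(φ_m)…) the claim fails, e.g. for the cycle x:=2x; x:=x-1. *)

(* Defs.v *)
From HB Require Import structures.
From mathcomp Require Import all_boot all_order all_algebra all_fingroup.
From mathcomp Require Import finmap.
From mathcomp.multinomials Require Import monalg.
From Stdlib Require Import Relation_Operators.

Set Implicit Arguments.
Unset Strict Implicit.
Unset Printing Implicit Defensive.

Import GRing.Theory Num.Theory.

Local Open Scope fset_scope.
Local Open Scope ring_scope.

Notation "{ 'vpoly' R [ V ] }" := {malg R[{cmonom V}]}
  (at level 0, R, V at level 2, format "{ 'vpoly'  R [ V ] }") : type_scope.

Definition var (V : choiceType) (v : V) : {vpoly int[V]} := << ucm v >>.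

(* Coefficients are sent along f and variables along h; instances are evaluation
   in a state, substitution of polynomials, and substitution of closed forms. *)
Definition peval (V : choiceType) (R S : comNzRingType) (f : R -> S) (h : V -> S)
    (p : {vpoly R[V]}) : S :=
  mmap f (fun m : {cmonom V} => \prod_(v <- finsupp m) h v ^+ m v) p.

Definition poly_over (V : choiceType) (R : comNzRingType) (D : {pred V})
    (p : {vpoly R[V]}) : bool :=
  all (fun m : {cmonom V} => all (fun v => v \in D) (finsupp m)) (msupp p).

Definition evalZ (V : choiceType) (s : V -> int) (p : {vpoly int[V]}) : int :=
  peval idfun s p.

Definition evalQ (V : choiceType) (s : V -> int) (p : {vpoly rat[V]}) : rat :=
  peval idfun (fun v => (s v)%:~R) p.

Definition psubst (V : choiceType) (h : V -> {vpoly int[V]})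
    (p : {vpoly int[V]}) : {vpoly int[V]} :=
  peval (fun c : int => c%:MP) h p.

(* The atom (s1, s2) stands for s1 < s2. *)
Definition atom (V : choiceType) : Type := ({vpoly int[V]} * {vpoly int[V]})%type.
HB.instance Definition _ (V : choiceType) := Choice.on (atom V).

Inductive formula (V : choiceType) : Type :=
  | FAtom of atom V
  | FAnd of formula V & formula V
  | FOr of formula V & formula V.

Fixpoint formula_tree (V : choiceType) (f : formula V) : GenTree.tree (atom V) :=
  match f with
  | FAtom a => GenTree.Leaf a
  | FAnd f1 f2 => GenTree.Node 0 [:: formula_tree f1; formula_tree f2]
  | FOr f1 f2 => GenTree.Node 1 [:: formula_tree f1; formula_tree f2]
  end.

Fixpoint tree_formula (V : choiceType) (t : GenTree.tree (atom V)) :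
    option (formula V) :=
  match t with
  | GenTree.Leaf a => Some (FAtom a)
  | GenTree.Node k [:: t1; t2] =>
      if (tree_formula t1, tree_formula t2) is (Some f1, Some f2)
      then Some (if k is 0%N then FAnd f1 f2 else FOr f1 f2) else None
  | _ => None
  end.

Lemma formula_treeK (V : choiceType) :
  pcancel (@formula_tree V) (@tree_formula V).
Proof. by elim=> //= f1 -> f2 ->. Qed.

HB.instance Definition _ (V : choiceType) :=
  Choice.copy (formula V) (pcan_type (@formula_treeK V)).

Fixpoint sat (V : choiceType) (s : V -> int) (f : formula V) : bool :=
  match f with
  | FAtom a => evalZ s a.1 < evalZ s a.2
  | FAnd f1 f2 => sat s f1 && sat s f2
  | FOr f1 f2 => sat s f1 || sat s f2
  end.

Fixpoint fsubst (V : choiceType) (h : V -> {vpoly int[V]}) (f : formula V) :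
    formula V :=
  match f with
  | FAtom a => FAtom (psubst h a.1, psubst h a.2)
  | FAnd f1 f2 => FAnd (fsubst h f1) (fsubst h f2)
  | FOr f1 f2 => FOr (fsubst h f1) (fsubst h f2)
  end.

Fixpoint atoms (V : choiceType) (f : formula V) : seq (atom V) :=
  match f with
  | FAtom a => [:: a]
  | FAnd f1 f2 | FOr f1 f2 => atoms f1 ++ atoms f2
  end.

Definition formula_over (V : choiceType) (D : {pred V}) (f : formula V) : bool :=
  all (fun a : atom V => poly_over D a.1 && poly_over D a.2) (atoms f).

Definition entails (V : choiceType) (f : formula V) (Q : (V -> int) -> bool) :
    Prop :=
  forall s : V -> int, sat s f -> Q s.

(* An update is a finite map whose domain is the set of program variables. *)
Definition update (V : choiceType) : Type := {fmap V -> {vpoly int[V]}}.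
HB.instance Definition _ (V : choiceType) := Choice.on (update V).

Definition upd_app (V : choiceType) (eta : update V) (v : V) : {vpoly int[V]} :=
  odflt (var v) eta.[? v]%fmap.

Definition upd_id (V : choiceType) (D : {fset V}) : update V :=
  [fmap v : D => var (val v)]%fmap.

(* The update that performs eta1 first and eta2 afterwards. As an operation on
   polynomials it substitutes eta2 first: p becomes eta1(eta2(p)). *)
Definition upd_seq (V : choiceType) (eta1 eta2 : update V) : update V :=
  [fmap v : domf eta2 => psubst (upd_app eta1) (upd_app eta2 (val v))]%fmap.

Definition transition (V : choiceType) (Loc : finType) : Type :=
  (Loc * formula V * update V * Loc)%type.
HB.instance Definition _ (V : choiceType) (Loc : finType) :=
  Choice.on (transition V Loc).

Section Transition.
Context {V : choiceType} {Loc : finType}.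
Definition src (t : transition V Loc) : Loc := t.1.1.1.
Definition guard (t : transition V Loc) : formula V := t.1.1.2.
Definition upd (t : transition V Loc) : update V := t.1.2.
Definition tgt (t : transition V Loc) : Loc := t.2.
End Transition.

Record program (V : choiceType) := Program {
  pvars : {fset V};
  loc : finType;
  init : loc;
  trans : {fset transition V loc}
}.

Definition wf_program (V : choiceType) (P : program V) : Prop :=
  forall t, t \in trans P -> tgt t <> init P /\ domf (upd t) = pvars P.

Definition config (V : choiceType) (P : program V) : Type :=
  (loc P * (V -> int))%type.

Definition rel_comp (A : Type) (R S : A -> A -> Prop) (x z : A) : Prop :=
  exists y, R x y /\ S y z.

Fixpoint rel_pow (A : Type) (R : A -> A -> Prop) (k : nat) : A -> A -> Prop :=
  if k is k'.+1 then rel_comp R (rel_pow R k') else eq.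

(* Temporary variables may take any value after a step. *)
Definition step (V : choiceType) (P : program V) (t : transition V (loc P))
    (c c' : config P) : Prop :=
  [/\ c.1 = src t, sat c.2 (guard t), c'.1 = tgt t &
      forall v, v \in pvars P -> c'.2 v = evalZ c.2 (upd_app (upd t) v)].

Definition step_in (V : choiceType) (P : program V)
    (T : {fset transition V (loc P)}) (c c' : config P) : Prop :=
  exists2 t, t \in T & step t c c'.

Definition steps_in (V : choiceType) (P : program V)
    (T : {fset transition V (loc P)}) : config P -> config P -> Prop :=
  clos_refl_trans _ (step_in T).

Definition reach_via (V : choiceType) (P : program V) (r : transition V (loc P))
    (s0 : V -> int) (c : config P) : Prop :=
  rel_comp (steps_in (trans P)) (step r) (init P, s0) c.

Definition terminating (V : choiceType) (P : program V) : Prop :=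
  ~ exists2 c : nat -> config P,
      (c 0%N).1 = init P & forall i, step_in (trans P) (c i) (c i.+1).

Inductive bound (V : Type) : Type :=
  | BNat of nat
  | BOmega
  | BVar of V
  | BAdd of bound V & bound V
  | BMul of bound V & bound V
  | BExp of nat & bound V.
Arguments BNat {V}.
Arguments BOmega {V}.

Fixpoint bound_over (V : choiceType) (D : {pred V}) (b : bound V) : bool :=
  match b with
  | BNat _ | BOmega => true
  | BVar v => v \in D
  | BAdd b1 b2 | BMul b1 b2 => bound_over D b1 && bound_over D b2
  | BExp _ b1 => bound_over D b1
  end.

Fixpoint brename (V : Type) (f : V -> V) (b : bound V) : bound V :=
  match b with
  | BNat k => BNat k
  | BOmega => BOmega
  | BVar v => BVar (f v)
  | BAdd b1 b2 => BAdd (brename f b1) (brename f b2)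
  | BMul b1 b2 => BMul (brename f b1) (brename f b2)
  | BExp k b1 => BExp k (brename f b1)
  end.

(* Values of bounds: None is omega. Conventions: 0 * omega = 0, and k ^ omega is
   the limit of k ^ n, with 0 ^ omega = 0. *)
Definition enat : Type := option nat.

Definition eadd (x y : enat) : enat :=
  if (x, y) is (Some m, Some n) then Some (m + n)%N else None.

Definition emul (x y : enat) : enat :=
  match x, y with
  | Some m, Some n => Some (m * n)%N
  | Some 0, None | None, Some 0 => Some 0%N
  | _, _ => None
  end.

Definition eexp (k : nat) (x : enat) : enat :=
  if x is Some n then Some (k ^ n)%N else if (k <= 1)%N then Some k else None.

Definition nat_le_enat (k : nat) (x : enat) : bool :=
  if x is Some n then (k <= n)%N else true.

Fixpoint beval (V : Type) (e : V -> nat) (b : bound V) : enat :=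
  match b with
  | BNat k => Some k
  | BOmega => None
  | BVar v => Some (e v)
  | BAdd b1 b2 => eadd (beval e b1) (beval e b2)
  | BMul b1 b2 => emul (beval e b1) (beval e b2)
  | BExp k b1 => eexp k (beval e b1)
  end.

(* Reads a polynomial with nonnegative coefficients as a bound. *)
Definition bound_of_poly (V : choiceType) (p : {vpoly int[V]}) : bound V :=
  foldr (fun (m : {cmonom V}) b =>
           BAdd (BMul (BNat `|p@_m|%N)
                   (foldr (fun v b' => iter (m v) (BMul (BVar v)) b')
                      (BNat 1) (finsupp m))) b)
    (BNat 0) (msupp p).

Definition entry (V : choiceType) (P : program V)
    (T' : {fset transition V (loc P)}) (r : transition V (loc P)) : bool :=
  [&& r \in trans P, r \notin T' & has (fun t => tgt r == src t) T'].

(* b >= sup S is stated as: b is an upper bound of S. *)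
Definition local_runtime_bound (V : choiceType) (P : program V)
    (Tgt T' : {fset transition V (loc P)})
    (RB : transition V (loc P) -> bound V) : Prop :=
  (forall r, entry T' r -> bound_over [in pvars P] (RB r)) /\
  forall s r (sigma : V -> int), s \in Tgt -> entry T' r ->
    forall k : nat,
      (exists (sigma0 : V -> int) (l'' : loc P) (c' : config P),
         reach_via r sigma0 (l'', sigma) /\
         rel_pow (rel_comp (steps_in T') (step s)) k (l'', sigma) c') ->
      nat_le_enat k (beval (fun v => `|sigma v|%N) (RB r)).

Definition no_temporaries (V : choiceType) (P : program V)
    (t : transition V (loc P)) : Prop :=
  formula_over [in pvars P] (guard t) /\
  forall v, v \in pvars P -> poly_over [in pvars P] (upd_app (upd t) v).

Definition simple_cycle (V : choiceType) (P : program V)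
    (ts : seq (transition V (loc P))) : Prop :=
  [/\ ts <> [::],
      forall t, t \in ts -> no_temporaries t,
      uniq [seq src t | t <- ts] &
      path.cycle (fun t t' => tgt t == src t') ts].

Definition chain2 (V : choiceType) (Loc : finType) (s1 s2 : transition V Loc) :
    transition V Loc :=
  (src s1, FAnd (guard s1) (fsubst (upd_app (upd s1)) (guard s2)),
   upd_seq (upd s1) (upd s2), tgt s2).

Definition chain (V : choiceType) (Loc : finType) (s : transition V Loc)
    (ss : seq (transition V Loc)) : transition V Loc :=
  foldl (@chain2 V Loc) s ss.

Definition ren (V : choiceType) (D : {fset V}) (pi : {perm D}) (v : V) : V :=
  if insub v is Some u then val (pi u) else v.

Definition rename_formula (V : choiceType) (f : V -> V) : formula V -> formula V :=
  fsubst (fun v => var (f v)).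

Definition rename_trans (V : choiceType) (Loc : finType) (D : {fset V})
    (pi : {perm D}) (t : transition V Loc) : transition V Loc :=
  (src t, rename_formula (ren pi) (guard t),
   [fmap v : D => psubst (fun u => var (ren pi u))
                    (upd_app (upd t) (ren pi^-1%g (val v)))]%fmap,
   tgt t).

(* lvars lists x_1, ..., x_d in this order. *)
Record loop (V : choiceType) := Loop {
  lvars : seq V;
  lpre : formula V;
  lguard : formula V;
  lupd : update V
}.

(* eta x_k = c_k x_k + p_k with p_k over x_(k+1), ..., x_d and C c_k, for all k *)
Definition triangular (V : choiceType) (C : int -> Prop) (xs : seq V)
    (eta : update V) : Prop :=
  forall ys x zs, xs = ys ++ x :: zs ->
    exists (c : int) (p : {vpoly int[V]}),
      [/\ C c, poly_over [in zs] p & upd_app eta x = c *: var x + p].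

Definition twn_with (V : choiceType) (C : int -> Prop) (L : loop V) : Prop :=
  [/\ [/\ uniq (lvars L) & domf (lupd L) = [fset x in lvars L]],
      formula_over [in lvars L] (lpre L), formula_over [in lvars L] (lguard L),
      entails (lpre L) (fun s => sat s (fsubst (upd_app (lupd L)) (lpre L))) &
      triangular C (lvars L) (lupd L)].

Definition twn_loop (V : choiceType) (L : loop V) : Prop :=
  twn_with (fun=> True) L.

Definition tnn_loop (V : choiceType) (L : loop V) : Prop :=
  twn_with (fun c => 0 <= c) L.

(* The initial location is false, the location of the loop is true. *)
Definition loop_program (V : choiceType) (L : loop V) : program V :=
  @Program V [fset x in lvars L] bool false
    [fset ((false, lpre L, upd_id [fset x in lvars L], true) : transition V bool);
          ((true, lguard L, lupd L, true) : transition V bool)].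

Definition loop_sq (V : choiceType) (L : loop V) : loop V :=
  Loop (lvars L) (lpre L)
    (FAnd (lguard L) (fsubst (upd_app (lupd L)) (lguard L)))
    (upd_seq (lupd L) (lupd L)).

(* (b, a) : pexp stands for n ^ a * b ^ n, and sums of the p n ^ a b ^ n with p
   in a polynomial ring A form the monoid algebra {malg A[pexp]}. *)
Definition pexp : Type := (nat * nat)%type.
HB.instance Definition _ := Choice.on pexp.

Definition pexp1 : pexp := (1%N, 0%N).
Definition pexp_mul (k1 k2 : pexp) : pexp := ((k1.1 * k2.1)%N, (k1.2 + k2.2)%N).

Lemma pexp_mulA : associative pexp_mul.
Proof. by move=> [b a] [b' a'] [b'' a'']; rewrite /pexp_mul mulnA addnA. Qed.

Lemma pexp_mul1m : left_id pexp1 pexp_mul.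
Proof. by move=> [b a]; rewrite /pexp_mul mul1n. Qed.

Lemma pexp_mulm1 : right_id pexp1 pexp_mul.
Proof. by move=> [b a]; rewrite /pexp_mul muln1 addn0. Qed.

Lemma pexp_unitm k1 k2 : pexp_mul k1 k2 = pexp1 -> k1 = pexp1 /\ k2 = pexp1.
Proof.
move: k1 k2 => [b a] [b' a'] [] /eqP; rewrite muln_eq1 => /andP[/eqP-> /eqP->].
by move/eqP; rewrite addn_eq0 => /andP[/eqP-> /eqP->].
Qed.

Lemma pexp_mulC : commutative pexp_mul.
Proof. by move=> [b a] [b' a']; rewrite /pexp_mul mulnC addnC. Qed.

HB.instance Definition _ := Choice_isMonomialDef.Build pexp
  pexp_mulA pexp_mul1m pexp_mulm1 pexp_unitm.
HB.instance Definition _ := MonomialDef_isConomialDef.Build pexp pexp_mulC.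

Definition pexp_val (n : nat) (k : pexp) : nat := (n ^ k.2 * k.1 ^ n)%N.

Definition pexp_lt (k1 k2 : pexp) : bool :=
  (k1.1 < k2.1)%N || (k1.1 == k2.1) && (k1.2 < k2.2)%N.
Definition pexp_le (k1 k2 : pexp) : bool := (k1 == k2) || pexp_lt k1 k2.

Definition pe_eval (A R : comNzRingType) (ev : A -> R) (n : nat)
    (q : {malg A[pexp]}) : R :=
  mmap ev (fun k : pexp => (pexp_val n k)%:R) q.

Definition closed_form (V : choiceType) (xs : seq V) (eta : update V) (n0 : nat)
    (cf : V -> {malg {vpoly rat[V]}[pexp]}) : Prop :=
  forall x, x \in xs ->
    (forall k, k \in msupp (cf x) ->
       (0 < k.1)%N /\ poly_over [in xs] (cf x)@_k) /\
    (forall (s : V -> int) (n : nat), (n0 <= n)%N ->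
       pe_eval (evalQ s) n (cf x) =
       (evalZ s (iter n (psubst (upd_app eta)) (var x)))%:~R).

Definition denom_lcm (V : choiceType) (q : {malg {vpoly rat[V]}[pexp]}) : nat :=
  (\big[lcmn/1]_(k <- msupp q) \big[lcmn/1]_(m <- msupp q@_k)
     `|denq (q@_k)@_m|)%N.

(* npe is (s2 - s1)[x / cf x] times the lcm of its denominators; it has integer
   coefficients. *)
Definition is_npe (V : choiceType) (cf : V -> {malg {vpoly rat[V]}[pexp]})
    (al : atom V) (npe : {malg {vpoly int[V]}[pexp]}) : Prop :=
  let q := peval (fun c : int => c%:~R) cf (al.2 - al.1) in
  forall (k : pexp) (m : {cmonom V}),
    ((npe@_k)@_m)%:~R = (denom_lcm q)%:R * (q@_k)@_m :> rat.

Definition threshold (k : nat) (k1 k2 : pexp) (n0 : nat) : Prop :=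
  let above n0 := forall n, (n0 <= n)%N -> (k * pexp_val n k2 < pexp_val n k1)%N in
  above n0 /\ forall n1, above n1 -> (n0 <= n1)%N.

(* m is the maximum of the 1-monotonicity thresholds of the pairs in ks, all of
   which have to exist; it is 0 if there are none. *)
Definition max_threshold (ks : seq (pexp * pexp)) (m : nat) : Prop :=
  exists2 f : pexp * pexp -> nat,
    forall k, k \in ks -> threshold 1 k.1 k.2 (f k) & m = (\max_(k <- ks) f k)%N.

(* (p, (b, a)) stands for p n ^ a b ^ n. *)
Definition pterm (V : choiceType) : Type := ({vpoly int[V]} * pexp)%type.
HB.instance Definition _ (V : choiceType) := Choice.on (pterm V).

(* The choices made for one atom. A term t of Delta or Gamma with
   shift t = (j, i) is replaced by t.1 n ^ i j ^ n. Several terms of Lambda may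
   have the same monomial and the same exponents up to a constant factor. *)
Record approx (V : choiceType) := Approx {
  Lambda : {fset pterm V};
  Delta : {fset pterm V};
  Gamma : {fset pterm V};
  shift : pterm V -> pexp
}.

Definition npe_bar (V : choiceType) (ap : approx V) :
    {malg {vpoly int[V]}[pexp]} :=
  \sum_(t <- Lambda ap)
     << t.1 *g if t \in Delta ap `|` Gamma ap then shift ap t else t.2 >>.

Definition valid_approx (V : choiceType) (xs : seq V) (psi' : formula V)
    (npe : {malg {vpoly int[V]}[pexp]}) (ap : approx V) : Prop :=
  [/\ [/\ forall t, t \in Lambda ap ->
            poly_over [in xs] t.1 /\
            exists c (m : {cmonom V}), c != 0 /\ t.1 = << c *g m >>
        & npe = \sum_(t <- Lambda ap) << t.1 *g t.2 >>],
      [/\ Delta ap `<=` Lambda ap, Gamma ap `<=` Lambda ap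
        & [disjoint Delta ap & Gamma ap]],
      forall t, t \in Delta ap ->
        entails psi' (fun s => 0 < evalZ s t.1) /\ pexp_lt t.2 (shift ap t),
      forall t, t \in Gamma ap ->
        entails psi' (fun s => evalZ s t.1 <= 0) /\ pexp_lt (shift ap t) t.2
    & npe_bar ap <> npe ->
      forall s, sat s psi' ->
        exists N, forall n, (N <= n)%N -> pe_eval (evalZ s) n (npe_bar ap) <= 0].

Definition is_D (V : choiceType) (ap : approx V) (D : nat) : Prop :=
  max_threshold ([seq (shift ap t, t.2) | t <- Delta ap] ++
                 [seq (t.2, shift ap t) | t <- Gamma ap]) D.

(* Below, K j is (b_j, a_j) for 1 <= j <= l. *)
Definition is_M (K : nat -> pexp) (j M : nat) : Prop :=
  if (K j).1 == (K j.-1).1 then M = 0%N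
  else threshold 1 (K j) ((K j.-1).1, (K j.-1).2.+1) M.

Definition is_N (K : nat -> pexp) (j N : nat) : Prop :=
  if j == 2%N then N = 1%N else
  exists2 mt', threshold (j - 2) (K (j - 1)%N) (K (j - 2)%N) mt' &
    if j == 3%N then N = mt' else
    exists2 mt, max_threshold [seq (K (j - 2)%N, K i) | i <- iota 1 (j - 3)] mt &
      N = maxn mt mt'.

Definition sorted_keys (A : comNzRingType) (q : {malg A[pexp]}) : seq pexp :=
  sort pexp_le (msupp q).

Definition is_C (A : comNzRingType) (q : {malg A[pexp]}) (C : nat) : Prop :=
  let ks := sorted_keys q in
  let K j := nth pexp1 ks j.-1 in
  exists N M : nat -> nat,
    (forall j, (2 <= j <= size ks)%N -> is_N K j (N j) /\ is_M K j (M j)) /\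
    C = maxn 1 (\max_(2 <= j < (size ks).+1) maxn (N j) (M j)).

(* All coefficients but the one of the lexicographically largest (b, a). *)
Definition lower_coefs (A : comNzRingType) (q : {malg A[pexp]}) : seq A :=
  [seq q@_k | k <- take (size (sorted_keys q)).-1 (sorted_keys q)].

Definition sqcup (V : choiceType) (qs : seq {vpoly int[V]}) : {vpoly int[V]} :=
  [malg m in \bigcup_(q <- qs) msupp q => (\max_(q <- qs) `|q@_m|)%N%:Z].

Definition stab_bound (V : choiceType) (L : loop V) (B : {vpoly int[V]}) : Prop :=
  let As := atoms (lguard L) in
  exists (n0 : nat) (cf : V -> {malg {vpoly rat[V]}[pexp]})
         (npe : atom V -> {malg {vpoly int[V]}[pexp]}) (ap : atom V -> approx V)
         (C D : atom V -> nat),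
    [/\ closed_form (lvars L) (lupd L) n0 cf,
        forall al, al \in As ->
          [/\ is_npe cf al (npe al),
              valid_approx (lvars L) (FAnd (lpre L) (lguard L)) (npe al) (ap al),
              is_C (npe_bar (ap al)) (C al) & is_D (ap al) (D al)]
      & let Pol := flatten [seq lower_coefs (npe_bar (ap al)) | al <- As] in
        let Cmax := (\max_(al <- As) C al)%N in
        let Dmax := (\max_(al <- As) D al)%N in
        B = 2%:R * sqcup Pol + (maxn n0 (maxn Cmax Dmax))%:R].

Definition loop_bound (V : choiceType) (L : loop V) (B : bound V) : Prop :=
  let term := terminating (loop_program L) in
  [\/ [/\ term, tnn_loop L &
          exists2 sth, stab_bound L sth & B = bound_of_poly sth],
      [/\ term, twn_loop L /\ ~ tnn_loop L &
          exists2 sth, stab_bound (loop_sq L) sth &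
            B = BAdd (BMul (BNat 2) (bound_of_poly sth)) (BNat 1)]
    | ~ (term /\ twn_loop L) /\ B = BOmega].

Definition twn_renaming (V : choiceType) (P : program V)
    (t : transition V (loc P)) (pi : {perm pvars P}) (xs : seq V) : Prop :=
  let t' := rename_trans pi t in
  [/\ [/\ uniq xs & {subset xs <= pvars P}],
      formula_over [in xs] (guard t'),
      triangular (fun=> True) xs (upd t') &
      forall v, v \in pvars P -> v \notin xs -> upd_app (upd t') v = var v].

Definition valid_pre (V : choiceType) (P : program V) (r : transition V (loc P))
    (t : transition V (loc P)) (pi : {perm pvars P}) (xs : seq V)
    (psi : formula V) : Prop :=
  [/\ formula_over [in xs] psi,
      entails psi
        (fun s => sat s (fsubst (upd_app (upd (rename_trans pi t))) psi)) &
      forall (sigma0 sigma : V -> int),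
        reach_via r sigma0 (src t, sigma) ->
        sat sigma (rename_formula (ren pi^-1%g) psi)].

(* b is a possible result for the entry transition r, where t is the chained
   cycle starting in the target location of r *)
Definition entry_bound (V : choiceType) (P : program V)
    (r t : transition V (loc P)) (b : bound V) : Prop :=
  (exists (pi : {perm pvars P}) (xs : seq V) (psi : formula V) (B : bound V),
     let t' := rename_trans pi t in
     [/\ twn_renaming t pi xs, valid_pre r t pi xs psi,
         loop_bound (Loop xs psi (guard t') (upd t').[& [fset x in xs]]%fmap) B &
         b = brename (ren pi^-1%g) (BAdd (BNat 1) B)]) \/
  ((~ exists (pi : {perm pvars P}) (xs : seq V), twn_renaming t pi xs) /\
   b = BOmega).

Definition algorithm_output (V : choiceType) (P : program V)
    (ts : seq (transition V (loc P))) (RB : transition V (loc P) -> bound V) :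
    Prop :=
  forall r, entry [fset t in ts] r ->
  forall i s ss, (i < size ts)%N -> rot i ts = s :: ss -> tgt r = src s ->
    entry_bound r (chain s ss) (RB r).

(* Main.v *)
(* A simple cycle is deterministic on the program variables, so k executions of
   one of its transitions contain k - 1 complete rounds, that is, k - 1 iterations
   of the chained loop. In such a loop, an atom whose normalized poly-exponential
   expression has to be over-approximated is false once n passes the bound,
   because the approximation is eventually non-positive and its sign no longer
   changes. The truth value of every other atom is constant from there on. As
   guards are monotone in their atoms, a guard that holds at such an n holds
   forever, which contradicts termination. *)
From HB Require Import structures.
Require Import Defs.
From mathcomp Require Import all_boot all_order all_algebra all_fingroup finmap.
From mathcomp.multinomials Require Import monalg.
From mathcomp Require Import zify.

Set Implicit Arguments.
Unset Strict Implicit.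
Unset Printing Implicit Defensive.

Import Order.TTheory GRing.Theory Num.Theory.

Local Open Scope fset_scope.
Local Open Scope ring_scope.

(** * Polynomial evaluation as a ring morphism *)

(** The inner product of [peval], named so that it can carry a multiplicative structure. *)
Definition monom_val (V : choiceType) (S : comNzRingType) (h : V -> S)
  (m : {cmonom V}) : S := \prod_(v <- finsupp m) h v ^+ m v.

Lemma monom_valE (V : choiceType) (S : comNzRingType) (h : V -> S)
    (m : {cmonom V}) (E : {fset V}) :
  finsupp m `<=` E -> monom_val h m = \prod_(v <- E) h v ^+ m v.
Proof.
move=> sub; rewrite /monom_val; apply: big_fset_incl => // v _.
by rewrite -cmE_eq0 => /eqP ->; rewrite expr0.
Qed.

Lemma monom_val_mmorphism (V : choiceType) (S : comNzRingType) (h : V -> S) :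
  mmorphism (monom_val h).
Proof.
split=> [m1 m2|]; last by rewrite /monom_val mdom1 big_seq_fset0.
rewrite (@monom_valE _ _ h m1 (finsupp m1 `|` finsupp m2)) ?fsubsetUl //.
rewrite (@monom_valE _ _ h m2 (finsupp m1 `|` finsupp m2)) ?fsubsetUr //.
rewrite /monom_val mdomD -big_split /=; apply: eq_bigr => v _.
by rewrite cmM exprD.
Qed.

HB.instance Definition _ (V : choiceType) (S : comNzRingType) (h : V -> S) :=
  isMultiplicative.Build {cmonom V} S (monom_val h) (monom_val_mmorphism h).

(** Each evaluation map is convertible to [mmap] of a ring morphism and a multiplicative map, so it
    inherits the ring morphism structure. *)
HB.instance Definition _ (V : choiceType) (R S : comNzRingType)
    (f : {rmorphism R -> S}) (h : V -> S) :=
  GRing.RMorphism.copy (peval f h) (mmap f (monom_val h)).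

HB.instance Definition _ (V : choiceType) (s : V -> int) :=
  GRing.RMorphism.copy (evalZ s) (peval idfun s).

HB.instance Definition _ (V : choiceType) (s : V -> int) :=
  GRing.RMorphism.copy (evalQ s) (peval idfun (fun v => (s v)%:~R : rat)).

HB.instance Definition _ (V : choiceType) (h : V -> {vpoly int[V]}) :=
  GRing.RMorphism.copy (psubst h) (peval (@malgC {cmonom V} int) h).

Definition pexp_in (S : nzRingType) (n : nat) (k : pexp) : S := (pexp_val n k)%:R.

Lemma pexp_in_mmorphism (S : nzRingType) (n : nat) : mmorphism (@pexp_in S n).
Proof.
split=> [[b a] [b' a']|]; last by rewrite /pexp_in /pexp_val /= exp1n.
by rewrite /pexp_in -natrM /pexp_val /= expnMn expnD mulnACA.
Qed.

HB.instance Definition _ (S : nzRingType) (n : nat) :=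
  isMultiplicative.Build pexp S (@pexp_in S n) (pexp_in_mmorphism S n).

HB.instance Definition _ (A R : comNzRingType) (ev : {rmorphism A -> R})
    (n : nat) :=
  GRing.RMorphism.copy (pe_eval ev n) (mmap ev (@pexp_in R n)).

Lemma peval_var (V : choiceType) (S : comNzRingType)
    (f : {rmorphism int -> S}) (h : V -> S) v : peval f h (var v) = h v.
Proof.
by rewrite /peval mmapU /= rmorph1 mul1r mdomU big_seq_fset1 cmUU expr1.
Qed.

Lemma malg_monomM (K : monomType) (R : nzRingType) (k1 k2 : K) :
  << k1 >> * << k2 >> = << mmul k1 k2 >> :> {malg R[K]}.
Proof. by rewrite malgM_def fgmulUU mulr1. Qed.

Lemma malg_monomX (V : choiceType) (R : nzRingType) (v : V) (n : nat) :
  << ucm v >> ^+ n = << iter n (mmul (ucm v)) mone >> :> {vpoly R[V]}.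
Proof.
elim: n => [|n IH]; [exact: expr0 | rewrite exprS IH; exact: malg_monomM].
Qed.

Lemma monomE (V : choiceType) (R : comNzRingType) (m : {cmonom V}) :
  << m >> = \prod_(v <- finsupp m) << ucm v >> ^+ m v :> {vpoly R[V]}.
Proof.
under eq_bigr do rewrite malg_monomX.
have big : {morph (fun k => << k >> : {vpoly R[V]}) : k1 k2 /
    mmul k1 k2 >-> k1 * k2} by move=> k1 k2 /=; rewrite malg_monomM.
rewrite -(big_morph (fun k : {cmonom V} => << k >> : {vpoly R[V]})
  big (id2 := mone) (erefl _)); congr << _ >>; apply/eqP/cmP => i.
rewrite (big_morph (fun k : {cmonom V} => k i) (cmM i) (cm1 i)).
have itE v n : iter n (mmul (ucm v)) mone i = ((v == i) * n)%N.
  by elim: n => [|n IH] /=; rewrite ?cm1 ?muln0 // cmM IH cmU mulnS.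
rewrite (eq_bigr _ (fun v _ => itE v (m v))).
have [mi|mi] := boolP (i \in finsupp m).
  rewrite (big_fsetD1 i) //= eqxx mul1n big1_fset ?addn0 // => v.
  by rewrite !inE => /andP[/negPf->].
rewrite big_seq big1 => [|v vm]; first by apply/eqP; rewrite cmE_eq0.
by have [vi|_] := eqVneq v i; [rewrite vi (negPf mi) in vm | rewrite mul0n].
Qed.

Lemma poly_overP (V : choiceType) (R : comNzRingType) (D : {pred V})
    (p : {vpoly R[V]}) :
  reflect (forall m v, m \in msupp p -> v \in finsupp m -> v \in D)
    (poly_over D p).
Proof.
apply: (iffP allP) => [H m v /H /allP|H m mp]; first exact.
by apply/allP => v; apply: H.
Qed.

(** A ring morphism on integer polynomials is determined by its values on variables, since it has no
    choice on integer coefficients. This replaces inductions over polynomials for evaluation,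
    substitution and closed forms. *)
Lemma vpoly_morph_eq (V : choiceType) (S : comNzRingType)
    (f g : {rmorphism {vpoly int[V]} -> S}) (D : {pred V}) p :
  poly_over D p -> {in D, forall v, f (var v) = g (var v)} -> f p = g p.
Proof.
move=> /poly_overP pD fg; rewrite (monalgE p) !rmorph_sum /=.
rewrite big_seq [RHS]big_seq; apply: eq_bigr => m mp.
have -> : << p@_m *g m >> = (p@_m)%:MP * << m >> :> {vpoly int[V]}.
  by rewrite malgM_def fgmulUU mulr1 mul1m.
rewrite monomE !rmorphM !rmorph_prod; congr (_ * _).
  by rewrite -[p@_m]intz !rmorph_int.
by rewrite big_seq [RHS]big_seq; apply: eq_bigr => v /(pD _ _ mp) vD;
  rewrite !rmorphXn fg.
Qed.

Lemma poly_over_all (V : choiceType) (R : comNzRingType) (p : {vpoly R[V]}) :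
  poly_over predT p.
Proof. exact/poly_overP. Qed.

Lemma evalZ_var (V : choiceType) (s : V -> int) v : evalZ s (var v) = s v.
Proof. exact: peval_var. Qed.

Lemma psubst_var (V : choiceType) (h : V -> {vpoly int[V]}) v :
  psubst h (var v) = h v.
Proof. exact: peval_var. Qed.

Lemma eq_in_evalZ (V : choiceType) (D : {pred V}) (s s' : V -> int) p :
  poly_over D p -> {in D, s =1 s'} -> evalZ s p = evalZ s' p.
Proof.
move=> pD ss'; apply: (vpoly_morph_eq (f := evalZ s) (g := evalZ s') pD) => v vD.
by rewrite /= !evalZ_var ss'.
Qed.

Lemma eq_evalZ (V : choiceType) (s s' : V -> int) p :
  s =1 s' -> evalZ s p = evalZ s' p.
Proof. by move=> ss'; apply: (eq_in_evalZ (poly_over_all p)) => v _. Qed.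

Lemma evalZ_psubst (V : choiceType) (s : V -> int) h p :
  evalZ s (psubst h p) = evalZ (fun v => evalZ s (h v)) p.
Proof.
apply: (vpoly_morph_eq (f := evalZ s \o psubst h)
  (g := evalZ (fun v => evalZ s (h v))) (poly_over_all p)) => v _ /=.
by rewrite psubst_var evalZ_var.
Qed.

Lemma sat_fsubst (V : choiceType) (s : V -> int) h f :
  sat s (fsubst h f) = sat (fun v => evalZ s (h v)) f.
Proof.
elim: f => /= [a|f -> g ->|f -> g ->] => [|//|//].
exact: (f_equal2 <%R (evalZ_psubst s h a.1) (evalZ_psubst s h a.2)).
Qed.

Lemma eq_in_state_sat (V : choiceType) (D : {pred V}) (s s' : V -> int) f :
  formula_over D f -> {in D, s =1 s'} -> sat s f = sat s' f.
Proof.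
move=> + ss'; elim: f => /= [a|f IHf g IHg|f IHf g IHg].
- rewrite /formula_over /= andbT => /andP[a1 a2].
  exact: (f_equal2 <%R (eq_in_evalZ a1 ss') (eq_in_evalZ a2 ss')).
- by rewrite /formula_over /= all_cat => /andP[/IHf-> /IHg->].
- by rewrite /formula_over /= all_cat => /andP[/IHf-> /IHg->].
Qed.

Lemma eq_state_sat (V : choiceType) (s s' : V -> int) f :
  s =1 s' -> sat s f = sat s' f.
Proof.
move=> ss'; apply: (@eq_in_state_sat _ predT) => [|v _]; last exact: ss'.
by apply/allP => a _; rewrite !poly_over_all.
Qed.

Lemma sub_poly_over (V : choiceType) (R : comNzRingType) (D E : {pred V})
    (p : {vpoly R[V]}) : {subset D <= E} -> poly_over D p -> poly_over E p.
Proof.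
by move=> DE /poly_overP pD; apply/poly_overP => m v mp /(pD m v mp)/DE.
Qed.

Lemma poly_over_subring (V : choiceType) (R : comNzRingType) (D : {pred V}) :
  subring_closed [pred p : {vpoly R[V]} | poly_over D p].
Proof.
split=> [|p q|p q]; rewrite ?inE.
- apply/poly_overP => m v; rewrite msuppU oner_eq0 inE => /eqP->.
  by rewrite mdom1.
- move=> /poly_overP pD /poly_overP qD; apply/poly_overP => m v.
  by move=> /(fsubsetP (msuppB_le _ _)); rewrite inE => /orP[/pD|/qD]; apply.
- move=> /poly_overP pD /poly_overP qD; apply/poly_overP => m v.
  move=> /msuppM_le[m1 [m2 [m1p m2q ->]]]; rewrite mdomD inE.
  by case/orP; [apply: pD | apply: qD].
Qed.

HB.instance Definition _ (V : choiceType) (R : comNzRingType) (D : {pred V}) :=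
  GRing.isSubringClosed.Build {vpoly R[V]} [pred p : {vpoly R[V]} | poly_over D p]
    (poly_over_subring R D).

(** * Sign stability of poly-exponential expressions *)

Lemma pexp_le_total : total pexp_le.
Proof.
move=> [b a] [b' a']; rewrite /pexp_le /pexp_lt !xpair_eqE /=.
by case: (ltngtP b b'); case: (ltngtP a a').
Qed.

Lemma pexp_le_trans : transitive pexp_le.
Proof.
move=> [b' a'] [b a] [b'' a'']; rewrite /pexp_le /pexp_lt !xpair_eqE /=; lia.
Qed.

Lemma pexp_val_gt0 n k : (0 < n)%N -> (0 < k.1)%N -> (0 < pexp_val n k)%N.
Proof. by move=> n0 k0; rewrite /pexp_val muln_gt0 !expn_gt0 n0 k0. Qed.

Lemma pexp_val_eq0 n k : (0 < n)%N -> k.1 = 0%N -> pexp_val n k = 0%N.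
Proof. by move=> n0 k0; rewrite /pexp_val k0 exp0n ?muln0. Qed.

Lemma max_thresholdP ks m k n : max_threshold ks m -> k \in ks -> (m <= n)%N ->
  (pexp_val n k.2 < pexp_val n k.1)%N.
Proof.
move=> [f fP ->] kks mn; have [above _] := fP _ kks.
have := above n; rewrite mul1n; apply; apply: leq_trans mn.
exact: leq_bigmax_seq.
Qed.

Section SortedKeys.
Context {A : comNzRingType} (q : {malg A[pexp]}).
Let ks := sorted_keys q.
(** Indices start at 0 here, whereas [is_C], [is_N] and [is_M] count from 1. *)
Let K j := nth pexp1 ks j.

Lemma sorted_keys_lt i j : (i < j < size ks)%N -> pexp_lt (K i) (K j).
Proof.
move=> /andP[ij jks]; have iks := ltn_trans ij jks.
have /orP[|//] : pexp_le (K i) (K j).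
  apply: (sorted_ltn_nth pexp_le_trans) => //.
  exact: (sort_sorted pexp_le_total).
by rewrite nth_uniq ?sort_uniq ?fset_uniq // (ltn_eqF ij).
Qed.

Context {C : nat} (qC : is_C q C).

Lemma is_C_gt0 : (0 < C)%N.
Proof. by have [N [M [_ ->]]] := qC; rewrite leq_max. Qed.

Lemma is_C_NM j : (0 < j < size ks)%N -> exists N M,
  [/\ is_N (fun j => nth pexp1 ks j.-1) j.+1 N,
      is_M (fun j => nth pexp1 ks j.-1) j.+1 M & (maxn N M <= C)%N].
Proof.
move=> /andP[j0 jl]; have [N [M [NM ->]]] := qC.
exists (N j.+1), (M j.+1); have [|? ?] := NM j.+1; first by rewrite !ltnS j0.
split=> //; apply: leq_trans (leq_maxr _ _).
apply: (leq_bigmax_seq j.+1 (F := fun j => maxn (N j) (M j))) => //.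
by rewrite mem_index_iota !ltnS j0.
Qed.

(** If the two bases agree, the exponent of [n] grows by at least 1 because the keys increase
    strictly. Otherwise the threshold [M] compares with the lower key whose exponent is raised by 1,
    which is the factor [n]. *)
Lemma pexp_val_growth n j : (0 < j < size ks)%N -> (C <= n)%N ->
  (n * pexp_val n (K j.-1) <= pexp_val n (K j))%N.
Proof.
move=> jl Cn; have n0 := leq_trans is_C_gt0 Cn.
have [N [M [_ + ]]] := is_C_NM jl; rewrite /is_M /= geq_max.
have -> : (n * pexp_val n (K j.-1) =
    pexp_val n ((K j.-1).1, (K j.-1).2.+1))%N by rewrite /pexp_val expnS mulnA.
case: eqP => [bE _ _|_ [above _] /andP[_ MC]]; last first.
  by have := above n (leq_trans MC Cn); rewrite mul1n => /ltnW.
have /sorted_keys_lt : (j.-1 < j < size ks)%N by lia.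
rewrite -/(K j) -/(K j.-1) in bE; rewrite /pexp_lt bE ltnn eqxx /= => lt.
by rewrite /pexp_val /= bE leq_mul2r leq_pexp2l ?orbT.
Qed.

(** By the threshold [mt], none of the [j.-1] summands exceeds the last one, and [mt'] makes
    [pexp_val n (K j.-1)] exceed [j.-1] times that last one. *)
Lemma sum_pexp_val_lt n j : (j < size ks)%N -> (1 < j)%N -> (C <= n)%N ->
  (\sum_(i < j.-1) pexp_val n (K i) < pexp_val n (K j.-1))%N.
Proof.
move=> jl j1 Cn; have [|N [M [+ _ +]]] := @is_C_NM j.
  by rewrite jl (ltnW j1).
rewrite geq_max => + /andP[NC _]; have Nn := leq_trans NC Cn.
case: j j1 jl => // -[//|j] _ jl; rewrite /is_N /= => -[mt' [above _] Nm].
rewrite subSS subn1 /= in above.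
have mt'n : (mt' <= n)%N.
  by case: ifP Nm => _ => [NE|[mt _ NE]]; rewrite NE ?geq_max in Nn; lia.
apply: leq_ltn_trans (above n mt'n).
rewrite -[X in (_ <= X * _)%N](card_ord j.+1) -sum_nat_const.
apply: leq_sum => i _; have [->//|ij] := eqVneq (i : nat) j.
case: ifP Nm => [/eqP jE|_ [mt mtP NE]]; first by have := ltn_ord i; lia.
rewrite NE geq_max in Nn; case/andP: Nn => mtn _.
apply: ltnW; apply: (max_thresholdP (k := (K j, K i)) mtP) mtn.
apply/mapP; exists i.+1 => //; rewrite mem_iota /=.
by have := ltn_ord i; lia.
Qed.

Lemma absz_sum_le (j : nat) (c : nat -> int) (f : nat -> nat) :
  (`|(\sum_(i < j) c i * (f i)%:Z)%R| <= \sum_(i < j) `|c i| * f i)%N.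
Proof.
elim: j => [|j IH]; first by rewrite !big_ord0.
rewrite !big_ord_recr /= -[f j in leqRHS]absz_nat -abszM.
by move: (\sum_(i < j) _)%R (\sum_(i < j) _)%N (c j * _)%R IH => S T x; lia.
Qed.

(* The lower powers sum up to less than [2 * pexp_val n (K j.-1)], whereas
   [pexp_val n (K j)] is at least [n * pexp_val n (K j.-1)]. *)
Lemma dominant_pexp n j (c : nat -> int) : (j < size ks)%N -> (C <= n)%N ->
  (forall i, (i < j)%N -> (2 * `|c i| <= n)%N) -> (0 < (K j).1)%N ->
  (`|(\sum_(i < j) c i * (pexp_val n (K i))%:Z)%R| < pexp_val n (K j))%N.
Proof.
move=> jl Cn cn Kj; have n0 := leq_trans is_C_gt0 Cn.
have fj := pexp_val_gt0 n0 Kj.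
case: j jl cn Kj fj => [|j] jl cn Kj fj; first by rewrite big_ord0.
have := @pexp_val_growth n j.+1 jl Cn; rewrite /= => grow.
apply: leq_ltn_trans (absz_sum_le _ _ (fun i => pexp_val n (K i))) _.
(* The factor 2 of the stabilization bound enters here; it cancels the 2 in [lt]. *)
have le : (2 * (\sum_(i < j.+1) `|c i| * pexp_val n (K i)) <=
    n * (\sum_(i < j.+1) pexp_val n (K i)))%N.
  rewrite !big_distrr; apply: leq_sum => i _ /=.
  by rewrite mulnA leq_mul2r cn ?orbT.
(* The strict bound fails for a single lower term of base 0, but then the sum vanishes. *)
have lt : (\sum_(i < j.+1) pexp_val n (K i) < 2 * pexp_val n (K j) \/
    \sum_(i < j.+1) pexp_val n (K i) = 0)%N.
  have [j0|j0] := posnP j.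
    rewrite j0 big_ord1; case: (pexp_val n (K 0)) => [|x]; [by right | left].
    by lia.
  left; rewrite big_ord_recr mul2n -addnn ltn_add2r.
  exact: (@sum_pexp_val_lt n j.+1 jl j0 Cn).
set S := (X in (X < _)%N) in le *.
by case: lt le => [lt le|->]; [nia | lia].
Qed.

(** The sign is that of the topmost nonzero coefficient. The induction on the number of terms drops
    top terms whose coefficient vanishes, which can happen in a particular state. The last
    coefficient needs no bound, as no other term has to dominate it. *)
Lemma sum_pexp_sign_stable (c : nat -> int) X :
  (forall i, (i < (size ks).-1)%N -> (2 * `|c i| <= X)%N) ->
  exists b : bool, forall n, (maxn X C <= n)%N ->
    (0 < \sum_(i < size ks) c i * (pexp_val n (K i))%:Z) = b.
Proof.
move=> cX; suff /(_ (size ks) (leqnn _)) : forall m, (m <= size ks)%N ->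
  exists b : bool, forall n, (maxn X C <= n)%N ->
    (0 < \sum_(i < m) c i * (pexp_val n (K i))%:Z) = b by [].
elim=> [_|m IH ml]; first by exists false => n _; rewrite big_ord0.
have [c0|c0] := eqVneq (c m) 0.
  have [b bP] := IH (ltnW ml); exists b => n /bP <-.
  by rewrite big_ord_recr /= c0 mul0r addr0.
have [K0|Km] := posnP (K m).1.
  (* If the top key has base 0, so have all lower ones, and every term vanishes because [n] is
     positive. *)
  exists false => n; rewrite geq_max => /andP[_ Cn].
  have n0 := leq_trans is_C_gt0 Cn.
  rewrite big1 // => i _; rewrite pexp_val_eq0 ?mulr0 //.
  have [->//|im] := eqVneq (i : nat) m.
  have /sorted_keys_lt : (i < m < size ks)%N by have := ltn_ord i; lia.
  by rewrite /pexp_lt -/(K _) -/(K _) K0 /=; lia.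
exists (0 < c m) => n; rewrite geq_max => /andP[Xn Cn].
rewrite big_ord_recr /=.
have := @dominant_pexp n m c ml Cn _ Km.
move: (pexp_val n (K m)) (\sum_(i < m) _) => f S /(_ _)/wrap[].
  by move=> i im; apply: leq_trans (cX _ _) Xn; lia.
by move: (c m) c0 => d; nia.
Qed.

End SortedKeys.

Lemma pe_eval_sorted (A : comNzRingType) (ev : A -> int) n (q : {malg A[pexp]}) :
  let ks := sorted_keys q in
  pe_eval ev n q = \sum_(i < size ks) ev q@_(nth pexp1 ks i) *
    (pexp_val n (nth pexp1 ks i))%:Z.
Proof.
move=> ks; rewrite /pe_eval mmapE -(perm_big _ (permEl (perm_sort pexp_le (msupp q)))).
rewrite -/ks (big_nth pexp1) big_mkord; apply: eq_bigr => i _.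
by rewrite natz.
Qed.

Lemma pe_eval_sign_stable (A : comNzRingType) (ev : A -> int)
    (q : {malg A[pexp]}) C X : is_C q C ->
  (forall a, a \in lower_coefs q -> (2 * `|ev a| <= X)%N) ->
  exists b : bool, forall n, (maxn X C <= n)%N -> (0 < pe_eval ev n q) = b.
Proof.
move=> qC aX.
have [i il|b bP] := sum_pexp_sign_stable qC
  (c := fun i => ev q@_(nth pexp1 (sorted_keys q) i)) (X := X).
  apply: aX; apply/mapP; exists (nth pexp1 (sorted_keys q) i) => //.
  rewrite -(nth_take _ il) mem_nth // size_take; case: ifP => // _.
  by apply: leq_trans il (leq_pred _).
by exists b => n /bP <-; rewrite pe_eval_sorted.
Qed.

(** * Stabilization bounds *)

(** A deterministic counterpart of [step]: variables outside the domain of [eta] keep their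
    values. *)
Definition next_state (V : choiceType) (eta : update V) (s : V -> int) : V -> int :=
  fun v => evalZ s (upd_app eta v).

(** The outermost substitution corresponds to the first step of the run, so the induction
    generalizes over the start state. *)
Lemma evalZ_iter_psubst (V : choiceType) (eta : update V) s p n :
  evalZ s (iter n (psubst (upd_app eta)) p) = evalZ (iter n (next_state eta) s) p.
Proof.
elim: n s => [//|n IH] s; have -> : iter n.+1 (next_state eta) s =
    iter n (next_state eta) (next_state eta s) by rewrite iterSr.
exact: etrans (evalZ_psubst _ _ _) (IH _).
Qed.

Lemma pe_evalU (A R : comNzRingType) (ev : {rmorphism A -> R}) n c k :
  pe_eval ev n << c *g k >> = ev c * (pexp_val n k)%:R.
Proof. exact: mmapU. Qed.

Lemma evalZ_scale (V : choiceType) (s : V -> int) (p : {vpoly int[V]})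
    (q : {vpoly rat[V]}) (c : rat) :
  (forall m, (p@_m)%:~R = c * q@_m) -> (evalZ s p)%:~R = c * evalQ s q.
Proof.
move=> pq.
have pE := mmapEw (f := idfun) (h := monom_val s) (fsubsetUl (msupp p) (msupp q)).
have qE := mmapEw (f := idfun) (h := monom_val (fun v => (s v)%:~R))
  (fsubsetUr (msupp p) (msupp q)).
transitivity ((mmap idfun (monom_val s) p)%:~R : rat); first exact: erefl.
transitivity (c * mmap idfun (monom_val (fun v => (s v)%:~R)) q); last exact: erefl.
rewrite pE qE rmorph_sum mulr_sumr; apply: eq_bigr => m _ /=.
rewrite rmorphM /= pq mulrA; congr (_ * _).
by rewrite rmorph_prod; apply: eq_bigr => v _; rewrite rmorphXn.
Qed.

Lemma pe_eval_scale (V : choiceType) (s : V -> int) n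
    (p : {malg {vpoly int[V]}[pexp]}) (q : {malg {vpoly rat[V]}[pexp]}) (c : rat) :
  (forall k m, ((p@_k)@_m)%:~R = c * (q@_k)@_m) ->
  (pe_eval (evalZ s) n p)%:~R = c * pe_eval (evalQ s) n q.
Proof.
move=> pq.
have pE := mmapEw (f := evalZ s) (h := @pexp_in int n)
  (fsubsetUl (msupp p) (msupp q)).
have qE := mmapEw (f := evalQ s) (h := @pexp_in rat n)
  (fsubsetUr (msupp p) (msupp q)).
transitivity ((mmap (evalZ s) (@pexp_in int n) p)%:~R : rat); first exact: erefl.
transitivity (c * mmap (evalQ s) (@pexp_in rat n) q); last exact: erefl.
rewrite pE qE rmorph_sum mulr_sumr; apply: eq_bigr => k _ /=.
rewrite rmorphM mulrA; congr (_ * _); first exact: evalZ_scale (pq k).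
exact: rmorph_nat.
Qed.

Lemma denom_lcm_gt0 (V : choiceType) (q : {malg {vpoly rat[V]}[pexp]}) :
  (0 < denom_lcm q)%N.
Proof.
rewrite /denom_lcm; apply: (big_ind (leq 1)) => // [x y|k _].
  by rewrite lcmn_gt0 => -> ->.
apply: (big_ind (leq 1)) => // [x y|m _]; first by rewrite lcmn_gt0 => -> ->.
by rewrite absz_gt0 denq_neq0.
Qed.

(** Multiplication by the positive lcm of the denominators preserves the sign of the difference of
    the two sides. *)
Lemma npe_sign (V : choiceType) (xs : seq V) eta n0 cf (al : atom V) npe s n :
  closed_form xs eta n0 cf -> is_npe cf al npe ->
  poly_over [in xs] al.1 -> poly_over [in xs] al.2 -> (n0 <= n)%N ->
  (evalZ (iter n (next_state eta) s) al.1 < evalZ (iter n (next_state eta) s) al.2) =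
  (0 < pe_eval (evalZ s) n npe).
Proof.
move=> cfE npeE al1 al2 n0n; set sn := iter n _ s.
(* Both sides are ring morphisms applied to the same polynomial, and they agree on the variables by
   the closed form. *)
have alE : pe_eval (evalQ s) n (peval intr cf (al.2 - al.1)) =
    (evalZ sn (al.2 - al.1))%:~R.
  apply: (vpoly_morph_eq (f := pe_eval (evalQ s) n \o peval intr cf)
    (g := intr \o evalZ sn) (D := [in xs])) => [|x xxs /=].
    exact: (rpredB (S := [pred p | poly_over [in xs] p])).
  rewrite peval_var ((cfE x xxs).2 s n n0n); congr (_%:~R).
  exact: evalZ_iter_psubst.
have := pe_eval_scale s n npeE; rewrite [X in _ * X]alE => npeZ.
rewrite -(ltr0z rat) npeZ pmulr_rgt0 ?ltr0n ?denom_lcm_gt0 // ltr0z.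
by rewrite (rmorphB (evalZ sn)) subr_gt0.
Qed.

(** From [D] on, positive coefficients ([Delta]) get a larger power and non-positive ones ([Gamma])
    a smaller power, so no term decreases. The signs of the coefficients are known only for start
    states satisfying [psi']. *)
Lemma npe_le_npe_bar (V : choiceType) (xs : seq V) psi' npe (ap : approx V) D s n :
  valid_approx xs psi' npe ap -> is_D ap D -> sat s psi' -> (D <= n)%N ->
  pe_eval (evalZ s) n npe <= pe_eval (evalZ s) n (npe_bar ap).
Proof.
move=> [[_ ->] _ DeltaP GammaP _] DP spsi Dn; rewrite /npe_bar !rmorph_sum /=.
apply: ler_sum => t _; rewrite !pe_evalU !natz; case: ifP => [|//].
rewrite inE => /orP[tD|tG].
  have [/(_ s spsi) t0 _] := DeltaP t tD; rewrite ler_pM2l //.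
  apply/ltW/(max_thresholdP (k := (shift ap t, t.2)) DP) => //.
  by rewrite mem_cat (map_f (fun t => (shift ap t, t.2))).
have [/(_ s spsi) t0 _] := GammaP t tG; rewrite ler_wnM2l //.
apply/ltW/(max_thresholdP (k := (t.2, shift ap t)) DP) => //.
by rewrite mem_cat (map_f (fun t => (t.2, shift ap t))) ?orbT.
Qed.

Lemma npe_sign_stable (V : choiceType) (xs : seq V) psi' npe (ap : approx V)
    C D X s n n' :
  valid_approx xs psi' npe ap -> is_C (npe_bar ap) C -> is_D ap D ->
  sat s psi' ->
  (forall p, p \in lower_coefs (npe_bar ap) -> (2 * `|evalZ s p| <= X)%N) ->
  (maxn X (maxn C D) <= n)%N -> (maxn X (maxn C D) <= n')%N ->
  0 < pe_eval (evalZ s) n npe -> 0 < pe_eval (evalZ s) n' npe.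
Proof.
move=> apP CP DP spsi pX; rewrite !geq_max => /and3P[Xn Cn Dn] /and3P[Xn' Cn' Dn'].
have [b bP] := pe_eval_sign_stable CP pX.
have [apE|apN] := eqVneq (npe_bar ap) npe.
  by rewrite -apE !bP ?geq_max ?Xn ?Xn'.
have [_ _ _ _ /(_ (elimN eqP apN) s spsi)[N barN]] := apP.
have bF : b = false.
  (* At this index the sign has settled and the approximation is already non-positive. *)
  rewrite -(bP (maxn N (maxn X C))) ?leq_maxr // ltNge barN ?leq_maxl //.
move=> npe0; have := lt_le_trans npe0 (npe_le_npe_bar apP DP spsi Dn).
by rewrite bP ?bF // geq_max Xn.
Qed.

Lemma sat_atoms (V : choiceType) (s s' : V -> int) f :
  (forall al, al \in atoms f -> evalZ s al.1 < evalZ s al.2 ->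
    evalZ s' al.1 < evalZ s' al.2) -> sat s f -> sat s' f.
Proof.
elim: f => /= [al|f IHf g IHg|f IHf g IHg] H.
- by apply: H; rewrite inE.
- by case/andP => sf sg; rewrite IHf ?IHg // => al alf; apply: H;
    rewrite mem_cat alf ?orbT.
- by case/orP => sf; [rewrite IHf | rewrite IHg ?orbT] => // al alf; apply: H;
    rewrite mem_cat alf ?orbT.
Qed.

(** * Stabilization polynomials read as bounds *)

Lemma emulSS m n : emul (Some m) (Some n) = Some (m * n)%N.
Proof. by case: m. Qed.

Lemma beval_bound_of_poly (V : choiceType) (e : V -> nat) (p : {vpoly int[V]}) :
  beval e (bound_of_poly p) =
  Some (\sum_(m <- msupp p) `|p@_m| * \prod_(v <- finsupp m) e v ^ m v)%N.
Proof.
have monomE (m : {cmonom V}) (vs : seq V) :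
    beval e (foldr (fun v b => iter (m v) (BMul (BVar v)) b) (BNat 1) vs) =
    Some (\prod_(v <- vs) e v ^ m v)%N.
  elim: vs => [|v vs IH] /=; first by rewrite big_nil.
  rewrite big_cons; elim: (m v) => [|k IHk]; first by rewrite expn0 mul1n -IH.
  rewrite -[LHS]/(emul (Some (e v)) (beval e (iter k (BMul (BVar v)) _))).
  by rewrite IHk emulSS expnS -mulnA.
rewrite /bound_of_poly; elim: (enum_fset _) => [|m ms IH] /=.
  by rewrite big_nil.
by rewrite big_cons IH monomE -/(emul (Some _) (Some _)) emulSS.
Qed.

Lemma evalZ_expand (V : choiceType) (s : V -> int) (p : {vpoly int[V]})
    (d : {fset {cmonom V}}) : msupp p `<=` d ->
  evalZ s p = \sum_(m <- d) p@_m * monom_val s m.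
Proof. exact: mmapEw. Qed.

Lemma abs_monom_val (V : choiceType) (s : V -> int) (m : {cmonom V}) :
  `|monom_val s m| = monom_val (fun v => `|s v|%N%:Z) m.
Proof.
rewrite /monom_val normr_prod; apply: eq_bigr => v _.
by rewrite normrX abszE.
Qed.

(** [bound_of_poly] takes absolute values of coefficients, so it agrees with [p] when these are
    nonnegative. *)
Lemma beval_nonneg_poly (V : choiceType) (s : V -> int) (p : {vpoly int[V]}) :
  (forall m, 0 <= p@_m) ->
  exists2 N, beval (fun v => `|s v|%N) (bound_of_poly p) = Some N &
    N%:Z = evalZ (fun v => `|s v|%N%:Z) p.
Proof.
move=> p0; eexists; first exact: beval_bound_of_poly.
rewrite (evalZ_expand _ (fsubset_refl _)) -natz natr_sum; apply: eq_bigr => m _.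
rewrite natrM natz gez0_abs //; congr (_ * _).
rewrite natr_prod; apply: eq_bigr => v _.
by rewrite natrX natz.
Qed.

Lemma sqcupE (V : choiceType) (qs : seq {vpoly int[V]}) m :
  (sqcup qs)@_m = (\max_(q <- qs) `|q@_m|)%N%:Z.
Proof.
rewrite /sqcup mcoeffE; case: ifPn => // mqs; congr Posz.
elim: qs mqs => [|q qs IH]; rewrite ?big_nil // !big_cons inE negb_or.
by move=> /andP[/mcoeff_outdom-> /IH<-].
Qed.

(** Triangle inequality, with both polynomials expanded over a common set of monomials. *)
Lemma evalZ_sqcup_ge (V : choiceType) (s : V -> int) (qs : seq {vpoly int[V]}) p :
  p \in qs -> `|evalZ s p| <= evalZ (fun v => `|s v|%N%:Z) (sqcup qs).
Proof.
move=> pqs; pose E := msupp p `|` msupp (sqcup qs).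
rewrite (evalZ_expand s (fsubsetUl _ _ : _ `<=` E)).
rewrite (evalZ_expand _ (fsubsetUr _ _ : _ `<=` E)).
apply: le_trans (ler_norm_sum _ _ _) _; apply: ler_sum => m _.
rewrite normrM abs_monom_val ler_wpM2r //; first by rewrite -abs_monom_val.
by rewrite sqcupE -abszE lez_nat; apply: (leq_bigmax_seq p).
Qed.

(** A monomial whose maximal coefficient is nonzero occurs in some [q]. Lemmas of this kind ensure
    that the computed bounds mention program variables only. *)
Lemma sqcup_over (V : choiceType) (D : {pred V}) (qs : seq {vpoly int[V]}) :
  (forall q, q \in qs -> poly_over D q) -> poly_over D (sqcup qs).
Proof.
move=> qsD; apply/poly_overP => m v.
rewrite -mcoeff_neq0 sqcupE eqz_nat -lt0n => m0 vm.
have /hasP[q qqs qm] : has (fun q => 0 < `|q@_m|)%N qs.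
  apply: contraTT m0 => /hasPn qs0; rewrite -eqn0Ngt -leqn0; apply/bigmax_leqP_seq.
  by move=> q /qs0; rewrite -leqNgt.
have /poly_overP := qsD q qqs; apply; last exact: vm.
by rewrite -mcoeff_neq0 -absz_gt0.
Qed.

Definition stab_poly (V : choiceType) (qs : seq {vpoly int[V]}) (c : nat) :
  {vpoly int[V]} := 2%:R * sqcup qs + c%:R.

(** Both summands are nonnegative, so the value dominates each of them. These two estimates are what
    sign stability demands of an index. *)
Lemma beval_stab_poly (V : choiceType) (s : V -> int) (qs : seq {vpoly int[V]}) c :
  exists N, [/\ beval (fun v => `|s v|%N) (bound_of_poly (stab_poly qs c)) = Some N,
    (c <= N)%N & forall p, p \in qs -> (2 * `|evalZ s p| <= N)%N].
Proof.
have [m|N NE NB] := @beval_nonneg_poly _ s (stab_poly qs c).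
  rewrite mcoeffD mulr_natl mcoeffMn sqcupE -mpolyC_nat mcoeffC.
  by rewrite addr_ge0 ?mulrn_wge0.
set e := fun v => `|s v|%N%:Z in NB.
have {}NB : N%:Z = 2 * evalZ e (sqcup qs) + c%:Z.
  rewrite NB /stab_poly -[c%:Z]natz.
  by rewrite (rmorphD (evalZ e)) (rmorphM (evalZ e)) !(rmorph_nat (evalZ e)).
exists N; split=> // [|p /(evalZ_sqcup_ge s)].
  rewrite -lez_nat NB lerDr mulr_ge0 //.
  rewrite (evalZ_expand _ (fsubset_refl _)); apply: sumr_ge0 => m _.
  by rewrite mulr_ge0 ?sqcupE // -abs_monom_val.
by rewrite -/e => le; lia.
Qed.

Lemma npe_bar_over (V : choiceType) (xs : seq V) psi' npe (ap : approx V) p :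
  valid_approx xs psi' npe ap -> p \in lower_coefs (npe_bar ap) ->
  poly_over [in xs] p.
Proof.
move=> [[LambdaP _] _ _ _ _] /mapP[k _ ->]; rewrite /npe_bar raddf_sum /=.
rewrite big_seq; apply: (rpred_sum (S := [pred p | poly_over [in xs] p])).
move=> t /LambdaP[txs _]; rewrite mcoeffU.
exact: (rpredMn (S := [pred p | poly_over [in xs] p])).
Qed.

Lemma stab_poly_over (V : choiceType) (D : {pred V}) (qs : seq {vpoly int[V]}) c :
  (forall q, q \in qs -> poly_over D q) -> poly_over D (stab_poly qs c).
Proof.
move=> /sqcup_over qsD; rewrite /stab_poly.
apply: (rpredD (S := [pred p | poly_over D p])).
  by rewrite mulr_natl; apply: (rpredMn (S := [pred p | poly_over D p])).
exact: (rpred_nat [pred p | poly_over D p]).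
Qed.

Lemma bound_of_poly_over (V : choiceType) (D : {pred V}) (p : {vpoly int[V]}) :
  poly_over D p -> bound_over D (bound_of_poly p).
Proof.
move=> /poly_overP pD; rewrite /bound_of_poly.
have: {subset enum_fset (msupp p) <= msupp p} by [].
elim: (enum_fset _) => //= m ms IH sub.
rewrite IH ?andbT => [|k kms]; last by apply: sub; rewrite inE kms orbT.
have: {subset enum_fset (finsupp m) <= D}.
  by move=> v; apply: pD; rewrite sub ?mem_head.
elim: (enum_fset _) => //= v vs IHv sub'.
elim: (m v) => [|k IHk] /=; last by rewrite IHk sub' ?mem_head.
by apply: IHv => w wvs; apply: sub'; rewrite inE wvs orbT.
Qed.

(** * Runtime of twn-loops *)

(** If [m] exceeded [N], the guard would hold at index [m.-1], which is at least [N]; there all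
    atoms have settled, so it would hold at every later index too. *)
Lemma stab_boundP (V : choiceType) (L : loop V) B s :
  formula_over [in lvars L] (lguard L) -> stab_bound L B ->
  sat s (FAnd (lpre L) (lguard L)) ->
  ~ (forall i, sat (iter i (next_state (lupd L)) s) (lguard L)) ->
  exists2 N, beval (fun v => `|s v|%N) (bound_of_poly B) = Some N &
    forall m, (forall i, (i < m)%N -> sat (iter i (next_state (lupd L)) s) (lguard L)) ->
      (m <= N)%N.
Proof.
move=> Lover [n0 [cf [npe [ap [C [D [cfE alP ->]]]]]]] spsi Lfin.
set Pol := flatten _; set c := maxn n0 _.
have [N [NE cN polN]] := beval_stab_poly s Pol c; exists N => // m mP.
rewrite leqNgt; apply/negP => Nm; apply: Lfin => i.
have m0 : (0 < m)%N := leq_ltn_trans (leq0n N) Nm.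
have [/mP//|mi] := ltnP i m; have := mP m.-1; rewrite ltn_predL m0.
move=> /(_ isT); apply: sat_atoms => al alL.
have [npeE apP CP DP] := alP al alL.
have /andP[al1 al2] := allP Lover al alL.
move: cN; rewrite /c !geq_max => /and3P[n0N CN DN].
have {}CN : (C al <= N)%N by apply: leq_trans CN; exact: leq_bigmax_seq.
have {}DN : (D al <= N)%N by apply: leq_trans DN; exact: leq_bigmax_seq.
have Nm1 : (N <= m.-1)%N by rewrite -ltnS prednK.
have Ni : (N <= i)%N by apply: leq_trans (ltnW Nm) mi.
move=> lt; have := npe_sign s cfE npeE al1 al2 (leq_trans n0N Nm1).
rewrite lt => /esym pos.
apply: etrans (npe_sign s cfE npeE al1 al2 (leq_trans n0N Ni)) _.
apply: (npe_sign_stable (X := N) apP CP DP spsi) pos => [p pal||].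
- apply: polN; apply/flattenP; exists (lower_coefs (npe_bar (ap al))) => //.
  exact: (map_f (fun al => lower_coefs (npe_bar (ap al)))).
- by rewrite !geq_max Nm1 (leq_trans CN) ?(leq_trans DN).
- by rewrite !geq_max Ni (leq_trans CN) ?(leq_trans DN).
Qed.

Lemma stab_bound_over (V : choiceType) (L : loop V) B :
  stab_bound L B -> poly_over [in lvars L] B.
Proof.
move=> [n0 [cf [npe [ap [C [D [_ alP ->]]]]]]]; apply: stab_poly_over => q.
case/flattenP => qs /mapP[al /alP[_ apP _ _] ->]; exact: npe_bar_over apP.
Qed.

Lemma upd_app_id (V : choiceType) (E : {fset V}) v : upd_app (upd_id E) v = var v.
Proof. by rewrite /upd_app /upd_id; case: fndP => // vE; rewrite ffunE. Qed.

Lemma upd_app_dom (V : choiceType) (eta : update V) v :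
  v \notin domf eta -> upd_app eta v = var v.
Proof. by move=> vE; rewrite /upd_app not_fnd. Qed.

(** [upd_seq] takes its domain from [eta2]; equal domains ensure that no update of [eta1] is
    lost. *)
Lemma upd_app_seq (V : choiceType) (eta1 eta2 : update V) v :
  domf eta1 = domf eta2 ->
  upd_app (upd_seq eta1 eta2) v = psubst (upd_app eta1) (upd_app eta2 v).
Proof.
move=> dom; have [vE|vE] := boolP (v \in domf eta2).
  by rewrite {1}/upd_app /upd_seq in_fnd ffunE.
rewrite [LHS]upd_app_dom // [upd_app eta2 v]upd_app_dom //.
by apply: esym; apply: etrans (psubst_var _ _) _; rewrite upd_app_dom // dom.
Qed.

Lemma next_seq (V : choiceType) (eta1 eta2 : update V) s :
  domf eta1 = domf eta2 ->
  next_state (upd_seq eta1 eta2) s =1 next_state eta2 (next_state eta1 s).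
Proof.
move=> dom v; rewrite /next_state upd_app_seq //; exact: evalZ_psubst.
Qed.

Lemma eq_next (V : choiceType) (eta : update V) s s' :
  s =1 s' -> next_state eta s =1 next_state eta s'.
Proof. by move=> ss' v; apply: eq_evalZ. Qed.

Lemma iter_next_sq (V : choiceType) (eta : update V) n s :
  iter n (next_state (upd_seq eta eta)) s =1 iter n.*2 (next_state eta) s.
Proof.
elim: n => //= n IH v; rewrite next_seq //.
by do 2!apply: eq_next => {}v; apply: IH.
Qed.

Lemma terminating_guard_fails (V : choiceType) (L : loop V) s :
  domf (lupd L) = [fset x in lvars L] -> terminating (loop_program L) ->
  sat s (lpre L) -> ~ (forall i, sat (iter i (next_state (lupd L)) s) (lguard L)).
Proof.
move=> dom term spsi sguard; apply: term.
(* The initial transition leaves the state unchanged, so iterate [j] is configuration [j.+1]. *)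
exists (fun i : nat => if i is j.+1 then (true, iter j (next_state (lupd L)) s)
                       else (false, s)) => // -[|i].
  exists (false, lpre L, upd_id [fset x in lvars L], true).
    exact: fset21.
  split=> // v _; rewrite upd_app_id; exact/esym/evalZ_var.
exists (true, lguard L, lupd L, true); first exact: fset22.
split=> //; exact: sguard.
Qed.

Lemma psubst_over (V : choiceType) (D : {pred V}) h (p : {vpoly int[V]}) :
  poly_over D p -> {in D, forall v, poly_over D (h v)} -> poly_over D (psubst h p).
Proof.
move=> /poly_overP pD hD.
pose S := [pred p : {vpoly int[V]} | poly_over D p].
have -> : psubst h p = \sum_(m <- msupp p) (p@_m)%:MP * monom_val h m by exact: erefl.
rewrite big_seq; apply: (rpred_sum (S := S)) => m mp.
rewrite mul_malgC -[p@_m]intz scaler_int; apply: (rpredMz (S := S)).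
rewrite /monom_val big_seq; apply: (rpred_prod (S := S)) => v vm.
by apply: (rpredX (S := S)); apply: hD; apply: pD vm.
Qed.

Lemma fsubst_over (V : choiceType) (D : {pred V}) h f :
  formula_over D f -> {in D, forall v, poly_over D (h v)} ->
  formula_over D (fsubst h f).
Proof.
move=> + hD; elim: f => /= [a|f IHf g IHg|f IHf g IHg].
- rewrite /formula_over /= !andbT => /andP[a1 a2].
  by apply/andP; split; apply: psubst_over.
- rewrite /formula_over /= !all_cat => /andP[fD gD].
  by apply/andP; split; [apply: IHf | apply: IHg].
- rewrite /formula_over /= !all_cat => /andP[fD gD].
  by apply/andP; split; [apply: IHf | apply: IHg].
Qed.

Lemma triangular_over (V : choiceType) C (xs : seq V) eta :
  triangular C xs eta -> {in xs, forall v, poly_over [in xs] (upd_app eta v)}.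
Proof.
move=> tri v /[dup] vxs /splitPr xsE.
case: xsE vxs tri => ys zs vxs /(_ ys v zs erefl)[c [p [_ pzs ->]]].
set us := ys ++ _ in vxs *; pose S := [pred p : {vpoly int[V]} | poly_over [in us] p].
apply: (rpredD (S := S)); last first.
  apply: sub_poly_over pzs => w wzs.
  by rewrite [_ \in _]mem_cat [w \in v :: _]inE [w \in zs]wzs !orbT.
rewrite -[c]intz scaler_int; apply: (rpredMz (S := S)).
apply/poly_overP => m w; rewrite msuppU oner_eq0 inE => /eqP->.
by rewrite mdomU inE => /eqP->.
Qed.

(** In the case of a twn-loop that is not tnn, [m] iterations contain [m./2] iterations of the
    squared loop, whence twice its bound plus 1 for odd [m]. *)
Lemma loop_bound_sound (V : choiceType) (L : loop V) B s m :
  loop_bound L B -> sat s (lpre L) ->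
  (forall i, (i < m)%N -> sat (iter i (next_state (lupd L)) s) (lguard L)) ->
  nat_le_enat m (beval (fun v => `|s v|%N) B).
Proof.
case: m => [|m] LB spsi sguard; first by case: (beval _ _).
have sg0 : sat s (lguard L) := sguard 0%N isT.
case: LB => [[term [[_ dom] _ gover _ _] [sth sthP ->]]|
    [term [[[_ dom] _ gover _ tri] _] [sth sthP ->]]|[_ ->]] //.
  have [||N -> NP] := stab_boundP gover sthP (s := s).
  - by rewrite /= spsi.
  - exact: terminating_guard_fails.
  - exact: NP.
have sqE i : sat (iter i (next_state (lupd (loop_sq L))) s) (lguard (loop_sq L)) =
    sat (iter i.*2 (next_state (lupd L)) s) (lguard L) &&
    sat (iter i.*2.+1 (next_state (lupd L)) s) (lguard L).
  rewrite (eq_state_sat _ (iter_next_sq _ _ _)) /=; congr (_ && _).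
  exact: sat_fsubst.
have sqover : formula_over [in lvars L] (lguard (loop_sq L)).
  rewrite /formula_over /= all_cat -/(formula_over _ _) gover /=.
  by apply: fsubst_over gover _; apply: triangular_over tri.
rewrite -[beval _ _]/(eadd (emul (Some 2) (beval _ (bound_of_poly sth))) (Some 1))%N.
(* A single iteration need not satisfy the guard of the squared loop, so [stab_boundP] may not
   apply; the summand 1 covers it. *)
case: m sguard => [|m] sguard.
  by rewrite beval_bound_of_poly emulSS /= addn1.
have [||N NE NP] := stab_boundP sqover sthP (s := s).
- by have := sqE 0%N; rewrite /= => ->; rewrite spsi sg0; apply: (sguard 1%N).
(* Termination of [L] itself suffices: iterate [i] of [L] is checked by iterate [i./2] of the
   squared loop. *)
- move=> sqinf; apply: (terminating_guard_fails dom term spsi) => i.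
  have := sqinf i./2; rewrite sqE -[in X in _ -> X](odd_double_half i).
  by case: odd => /andP[].
rewrite NE emulSS /=.
have : (m.+2./2 <= N)%N.
  by apply: NP => i im; rewrite sqE !sguard //; lia.
lia.
Qed.

Lemma loop_bound_over (V : choiceType) (L : loop V) B :
  loop_bound L B -> bound_over [in lvars L] B.
Proof.
case=> [[_ _ [sth /stab_bound_over sthP ->]]|
    [_ _ [sth /stab_bound_over sthP ->]]|[_ ->]] //.
  exact: bound_of_poly_over.
by rewrite /= bound_of_poly_over.
Qed.

(** * Evaluations of simple cycles *)

Section ChainStates.
Context {V : choiceType} {Loc : finType}.
Implicit Types (s : V -> int) (t : transition V Loc) (ts : seq (transition V Loc)).

Definition run_states s ts : V -> int :=
  foldl (fun s' t => next_state (upd t) s') s ts.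

Fixpoint guards_hold s ts : bool :=
  if ts is t :: ts' then sat s (guard t) && guards_hold (next_state (upd t) s) ts'
  else true.

Lemma eq_guards_hold s s' ts : s =1 s' -> guards_hold s ts = guards_hold s' ts.
Proof.
elim: ts s s' => //= t ts IH s s' ss'.
by rewrite (eq_state_sat _ ss') (IH _ _ (eq_next _ ss')).
Qed.

Lemma eq_run_states s s' ts : s =1 s' -> run_states s ts =1 run_states s' ts.
Proof.
elim: ts s s' => //= t ts IH s s' ss'.
by apply: IH; apply: eq_next.
Qed.

(** As [chain] is a left fold, the induction absorbs the second transition into the head.
    Substitution into a guard turns into evaluation in the intermediate state. *)
Lemma chain_states (D : {fset V}) t ts :
  (forall u, u \in t :: ts -> domf (upd u) = D) ->
  [/\ domf (upd (chain t ts)) = D,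
      forall s, sat s (guard (chain t ts)) = guards_hold s (t :: ts)
    & forall s, next_state (upd (chain t ts)) s =1 run_states s (t :: ts)].
Proof.
elim: ts t => [|u ts IH] t dom.
  by split=> [|s|s]; rewrite ?dom ?mem_head //= andbT.
have tD := dom t (mem_head _ _).
have uD : domf (upd u) = D by apply: dom; rewrite !inE eqxx orbT.
have [|chD chg chn] := IH (chain2 t u).
  move=> w; rewrite inE => /predU1P[->|wts]; first exact: uD.
  by apply: dom; rewrite !inE wts !orbT.
have seqE s : next_state (upd (chain2 t u)) s =1
    next_state (upd u) (next_state (upd t) s) by apply: next_seq; rewrite tD.
split=> // s.
  apply: etrans (chg s) _; rewrite /= (eq_guards_hold _ (seqE s)) -andbA.
  by congr (_ && (_ && _)); apply: sat_fsubst.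
move=> v; apply: etrans (chn s v) _; exact: (eq_run_states _ (seqE s) v).
Qed.

Lemma guards_holdP t0 s ts :
  (forall j, (j < size ts)%N ->
     sat (run_states s (take j ts)) (guard (nth t0 ts j))) ->
  guards_hold s ts.
Proof.
elim: ts s => //= t ts IH s H; rewrite (H 0%N) // IH // => j jts.
exact: (H j.+1).
Qed.

End ChainStates.

Lemma src_chain (V : choiceType) (Loc : finType) (t : transition V Loc) ts :
  src (chain t ts) = src t.
Proof. by elim: ts t => //= u ts IH t; rewrite [LHS]IH. Qed.

Lemma cycle_nth (T : Type) (e : rel T) x (cyc : seq T) j :
  path.cycle e cyc -> (j < size cyc)%N ->
  e (nth x cyc j) (nth x cyc (j.+1 %% size cyc)).
Proof.
case: cyc => // y ys /= /(pathP x) H jn.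
have := H j; rewrite size_rcons => /(_ jn).
have -> : nth x (y :: rcons ys y) j = nth x (y :: ys) j.
  by rewrite -rcons_cons nth_rcons jn.
congr (e _ _); rewrite nth_rcons; move: jn; rewrite ltnS leq_eqVlt.
case/predU1P => [->|jys]; first by rewrite ltnn eqxx modnn.
by rewrite jys modn_small.
Qed.

(** The offset [n.-1 - p] moves the carry of the division to the steps congruent to [p], so that the
    quotient counts them. *)
Lemma ltn_div_round n p M : (p < n)%N -> (M %% n)%N = p ->
  ((M + (n.-1 - p)) %/ n < (M.+1 + (n.-1 - p)) %/ n)%N.
Proof.
move=> pn Mp; move: (M %/ n)%N (divn_eq M n) => q; rewrite Mp => ME.
have -> : (M + (n.-1 - p) = q * n + n.-1)%N by lia.
have -> : (M.+1 + (n.-1 - p) = q.+1 * n)%N by rewrite mulSn; lia.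
by rewrite mulnK ?divnMDl ?divn_small; lia.
Qed.

Section Cycle.
Context {V : choiceType} {P : program V} (cyc : seq (transition V (loc P))).
Context (t0 : transition V (loc P)) (sigma : V -> int).
Context (cyc_gt0 : (0 < size cyc)%N).
Context (cyc_notemp : forall t, t \in cyc -> no_temporaries t).
Context (cyc_src : uniq [seq src t | t <- cyc]).
Context (cycP : path.cycle (fun t t' => tgt t == src t') cyc).

Let n := size cyc.
Let tr j := nth t0 cyc (j %% n).

(** A reference run around the cycle in which variables outside the update domains stay fixed; an
    actual evaluation may change temporary variables. *)
Fixpoint cycle_state (N : nat) : V -> int :=
  if N is M.+1 then next_state (upd (tr M)) (cycle_state M) else sigma.

(** Agreement is required on program variables only, as temporary ones are arbitrary after a step.
    The guards passed so far are kept for use in [cycle_rounds]. *)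
Definition at_step (N : nat) (c : config P) : Prop :=
  [/\ c.1 = src (tr N), {in pvars P, c.2 =1 cycle_state N} &
      forall j, (j < N)%N -> sat (cycle_state j) (guard (tr j))].

Lemma tr_mem j : tr j \in cyc.
Proof. by rewrite mem_nth ?ltn_pmod. Qed.

Lemma src_inj : {in cyc &, injective src}.
Proof.
move=> t t' tc t'c tt'; rewrite -(nth_index t0 tc) -(nth_index t0 t'c).
congr nth; apply/eqP.
rewrite -(nth_uniq (src t0) _ _ cyc_src) ?size_map ?index_mem //.
by rewrite !(nth_map t0) ?index_mem // !nth_index // tt'.
Qed.

(** Pairwise different source locations leave one choice of transition, and without temporary
    variables its guard and update depend only on the values that are tracked. *)
Lemma at_step_step N t c c' : at_step N c -> t \in cyc -> step t c c' ->
  t = tr N /\ at_step N.+1 c'.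
Proof.
move=> [cN sN gN] tc [ct sat_t c't c'E].
have tE : t = tr N by apply: src_inj; rewrite ?tr_mem // -ct.
have [gover uover] := cyc_notemp tc.
split=> //; split=> [|v vP|j].
- apply: etrans c't _; apply/eqP.
  have /eqP := cycle_nth t0 cycP (ltn_pmod N cyc_gt0).
  by rewrite -/n -[nth _ _ (N %% n)]/(tr N) -tE => ->; rewrite /tr -addn1 modnDml addn1.
- apply: etrans (c'E v vP) _; rewrite /= -tE.
  exact: eq_in_evalZ (uover v vP) sN.
rewrite ltnS leq_eqVlt => /predU1P[->|/gN //].
by rewrite -tE -(eq_in_state_sat gover sN).
Qed.

Lemma at_step_steps N c c' : at_step N c -> steps_in [fset t in cyc] c c' ->
  exists2 M, (N <= M)%N & at_step M c'.
Proof.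
move=> + cc'; elim: cc' N => {c c'} [c c' [t tc st]|c|c1 c2 c3 _ IH1 _ IH2] N cN.
- have [|_ c'N] := at_step_step cN _ st; first by move: tc; rewrite inE.
  by exists N.+1.
- by exists N.
have [M NM /IH2[M' MM' c3M']] := IH1 N cN.
by exists M'; first exact: leq_trans NM MM'.
Qed.

(* [(N + (n.-1 - index s cyc)) %/ n] is the number of j < N whose j-th step
   executes s. *)
Lemma at_step_pow s k N c c' : s \in cyc -> at_step N c ->
  rel_pow (rel_comp (steps_in [fset t in cyc]) (step s)) k c c' ->
  exists M, at_step M c' /\
    (k + (N + (n.-1 - index s cyc)) %/ n <= (M + (n.-1 - index s cyc)) %/ n)%N.
Proof.
move=> sc; elim: k N c => [|k IH] N c cN /=.
  by move=> <-; exists N.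
move=> [c1 [[c2 [cc2 st]] c1c']].
have [M NM c2M] := at_step_steps cN cc2.
have [sE c1M] := at_step_step c2M sc st.
have [M' [c'M' le]] := IH _ _ c1M c1c'; exists M'; split=> //.
apply: leq_trans le; rewrite addSnnS leq_add2l.
apply: (@leq_ltn_trans ((M + (n.-1 - index s cyc)) %/ n)).
  by rewrite leq_div2r // leq_add2r.
have idx : (M %% n = index s cyc)%N.
  rewrite sE index_uniq ?ltn_pmod //; exact: map_uniq cyc_src.
by apply: ltn_div_round idx; rewrite index_mem.
Qed.

Lemma run_states_cycle q j : (j <= n)%N ->
  run_states (cycle_state (q * n)) (take j cyc) = cycle_state (q * n + j).
Proof.
elim: j => [|j IH] jn; first by rewrite take0 addn0.
rewrite (take_nth t0) // /run_states -cats1 foldl_cat /= -/(run_states _ _).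
have <- : tr (q * n + j) = nth t0 cyc j by rewrite /tr modnMDl modn_small.
rewrite (IH (ltnW jn)) addnS; exact: erefl.
Qed.

(** If [s] heads the cycle, its [k]-th execution is only the first step of round [k], so just [k.-1]
    rounds are sure to be complete. *)
Lemma cycle_rounds s k c' : s \in cyc ->
  rel_pow (rel_comp (steps_in [fset t in cyc]) (step s)) k
    (src (nth t0 cyc 0), sigma) c' ->
  forall i, (i < k.-1)%N -> guards_hold (cycle_state (i * n)) cyc.
Proof.
move=> sc run i ik.
have start : at_step 0 (src (nth t0 cyc 0), sigma).
  by split=> //=; rewrite /tr mod0n.
have [M [[_ _ gM] le]] := at_step_pow sc start run.
have ilt : (index s cyc < n)%N by rewrite index_mem.
have kM : (k * n <= M + n.-1)%N.
  apply: leq_trans (_ : (M + (n.-1 - index s cyc)) %/ n * n <= _)%N.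
    by rewrite leq_mul2r (leq_trans (leq_addr _ _) le) orbT.
  by apply: leq_trans (leq_divM _ _) _; rewrite leq_add2l leq_subr.
apply: (@guards_holdP _ _ t0) => j jn; rewrite run_states_cycle; last exact: ltnW.
have -> : nth t0 cyc j = tr (i * n + j) by rewrite /tr modnMDl modn_small.
apply: gM; rewrite -/n in jn; nia.
Qed.

Lemma iter_chain_cycle_state (D : {fset V}) t ts i : cyc = t :: ts ->
  (forall u, u \in cyc -> domf (upd u) = D) ->
  iter i (next_state (upd (chain t ts))) sigma =1 cycle_state (i * n).
Proof.
move=> cycE dom; rewrite cycE in dom; have [_ _ chn] := chain_states dom.
elim: i => // i IH v; rewrite iterS; apply: etrans (chn _ v) _.
apply: etrans (eq_run_states _ IH v) _; rewrite -cycE.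
by have := run_states_cycle i (leqnn n); rewrite take_size mulSnr => ->.
Qed.

End Cycle.

(** * Renaming of program variables *)

Section Renaming.
Context {V : choiceType} {D : {fset V}} (pi : {perm D}).

Lemma ren_in v (vD : v \in D) : ren pi v = val (pi [` vD]).
Proof. by rewrite /ren insubT. Qed.

Lemma ren_out v : v \notin D -> ren pi v = v.
Proof. by move=> vD; rewrite /ren insubN. Qed.

Lemma ren_mem v : v \in D -> ren pi v \in D.
Proof. by move=> vD; rewrite ren_in; apply: valP. Qed.

End Renaming.

Lemma renK (V : choiceType) (D : {fset V}) (pi : {perm D}) :
  cancel (ren pi) (ren pi^-1%g).
Proof.
move=> v; have [vD|vD] := boolP (v \in D); last by rewrite !ren_out.
rewrite (ren_in _ vD) (ren_in _ (valP _)); set u := FSetSub _.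
have -> : u = pi [` vD] by apply: val_inj.
by rewrite permK.
Qed.

Lemma sat_rename (V : choiceType) (s : V -> int) (f : V -> V) g :
  sat s (rename_formula f g) = sat (s \o f) g.
Proof.
apply: etrans (sat_fsubst _ _ _) _; apply: eq_state_sat => v; exact: evalZ_var.
Qed.

Lemma beval_brename (V : Type) (e : V -> nat) (f : V -> V) b :
  beval e (brename f b) = beval (e \o f) b.
Proof. by elim: b => //= [b1 -> b2 ->|b1 -> b2 ->|k b ->]. Qed.

Lemma bound_over_brename (V : choiceType) (D E : {pred V}) (f : V -> V) b :
  {in D, forall v, f v \in E} -> bound_over D b -> bound_over E (brename f b).
Proof.
by move=> DE; elim: b => //= b1 IH1 b2 IH2 /andP[/IH1-> /IH2->].
Qed.

(** A variable [v] of the renamed transition plays the role of [ren pi^-1 v] in [t], so states are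
    transported by precomposition with [ren pi^-1]. *)
Lemma next_state_rename (V : choiceType) (Loc : finType) (D : {fset V})
    (pi : {perm D}) (t : transition V Loc) (s : V -> int) :
  domf (upd t) = D ->
  next_state (upd (rename_trans pi t)) (s \o ren pi^-1%g) =1
  next_state (upd t) s \o ren pi^-1%g.
Proof.
move=> dom v; rewrite /next_state /=; have [vD|vD] := boolP (v \in D); last first.
  rewrite ren_out // !upd_app_dom ?dom //.
  by apply: etrans (evalZ_var _ _) (etrans _ (esym (evalZ_var _ _))); rewrite /= ren_out.
rewrite [upd_app (upd (rename_trans _ _)) v]/upd_app in_fnd ffunE /=.
apply: etrans (evalZ_psubst _ _ _) _; apply: eq_evalZ => u.
by apply: etrans (evalZ_var _ _) _; rewrite /= renK.
Qed.

Lemma upd_app_restrict (V : choiceType) (eta : update V) (E : {fset V}) v :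
  (v \notin E -> upd_app eta v = var v) -> upd_app eta.[& E]%fmap v = upd_app eta v.
Proof.
rewrite [upd_app _.[& E]%fmap v]/upd_app fnd_restrict.
by case: ifP => // _ /(_ isT) ->.
Qed.

(** Restricting the update to [xs] changes nothing, since the renamed update is the identity
    elsewhere. *)
Lemma iter_next_state_rename (V : choiceType) (P : program V)
    (t : transition V (loc P)) (pi : {perm pvars P}) (xs : seq V) (s : V -> int) i :
  domf (upd t) = pvars P -> twn_renaming t pi xs ->
  iter i (next_state (upd (rename_trans pi t)).[& [fset x in xs]]%fmap)
    (s \o ren pi^-1%g) =1 iter i (next_state (upd t)) s \o ren pi^-1%g.
Proof.
move=> dom [_ _ _ xsE]; elim: i => [|i IH] v; first exact: erefl.
rewrite !iterS.
apply: etrans (eq_next _ IH v) _.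
apply: etrans (next_state_rename pi _ dom v); rewrite /next_state upd_app_restrict //.
rewrite !inE => vxs; have [vP|vP] := boolP (v \in pvars P); first exact: xsE.
by rewrite upd_app_dom.
Qed.

Theorem theorem31 (V : choiceType) (P : program V)
    (ts : seq (transition V (loc P))) (RB : transition V (loc P) -> bound V) :
  wf_program P ->
  {subset ts <= trans P} ->
  simple_cycle ts ->
  algorithm_output ts RB ->
  local_runtime_bound [fset t in ts]%fset [fset t in ts]%fset RB.
Proof.
move=> wfP tsP [ts0 notemp usrc cycts] out.
have entryP r : entry [fset t in ts] r -> exists t us j,
    [/\ rot j ts = t :: us, tgt r = src t & entry_bound r (chain t us) (RB r)].
  move=> rE; have /and3P[_ _ /hasP[t tts /eqP rt]] := rE.
  rewrite inE in tts; have rotE := rot_index tts.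
  do 3!eexists; split; [exact: rotE | exact: rt |].
  by apply: (out r rE _ _ _ _ rotE rt); rewrite index_mem.
split=> [r /entryP[t [us [j [_ _ []]]]]|s r sigma sts rE k].
- move=> [pi [xs [psi [B [[[_ xsP] _ _ _] _ LB ->]]]]] /=.
  apply: bound_over_brename (loop_bound_over LB) => v vxs.
  by apply: ren_mem; apply: xsP.
- by case=> _ ->.
move=> [sigma0 [l'' [c' [reach run]]]].
have [t [us [j [rotE rt []]]]] := entryP r rE; last by case=> _ ->.
move=> [pi [xs [psi [B [twn [_ _ pre] LB ->]]]]].
have [_ [_ [_ _ l''E _]]] := reach; rewrite /= rt in l''E.
(* The cycle is rotated to start at the target of [r]; all properties of simple cycles survive
   rotation. *)
pose cyc := t :: us; have cycmem : cyc =i ts by move=> u; rewrite /cyc -rotE mem_rot.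
have dom u : u \in cyc -> domf (upd u) = pvars P.
  by rewrite cycmem => /tsP /wfP[].
have cyc0 : (0 < size cyc)%N by [].
have cycnt u : u \in cyc -> no_temporaries u by rewrite cycmem; apply: notemp.
have cycsrc : uniq [seq src u | u <- cyc] by rewrite /cyc -rotE map_rot rot_uniq.
have cyccyc : path.cycle (fun u u' => tgt u == src u') cyc.
  by rewrite /cyc -rotE rot_cycle.
have [chD chg _] := chain_states dom.
have scyc : s \in cyc by rewrite cycmem; rewrite inE in sts.
have runE : [fset u in cyc] = [fset u in ts].
  by apply/fsetP => u; rewrite !inE -in_cons; apply: cycmem.
rewrite l''E -runE in run.
have rounds := cycle_rounds (t0 := t) cyc0 cycnt cycsrc cyccyc scyc run.
rewrite beval_brename.
(* The complete rounds are iterations of the renamed chained loop; the possibly incomplete one is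
   paid for by the summand 1 in front of [B]. *)
have : nat_le_enat k.-1 (beval (fun v => `|(sigma \o ren pi^-1%g) v|%N) B).
  apply: (loop_bound_sound LB) => [|i ik] /=.
    rewrite -sat_rename; apply: (pre sigma0).
    by rewrite src_chain -l''E.
  rewrite (eq_state_sat _ (iter_next_state_rename sigma i chD twn)).
  rewrite sat_rename.
  rewrite (eq_state_sat _ (_ : _ =1 iter i (next_state (upd (chain t us))) sigma)).
    rewrite chg (eq_guards_hold _ (iter_chain_cycle_state t sigma i erefl dom)).
    exact: rounds.
  by move=> v /=; rewrite renK.
rewrite /=; case: (beval _ B) => //= N; lia.
Qed.
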